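(* Let $\lambda\geq 1$ be an integer and let $L$ be a frequency square of type $F(3\lambda;\lambda,\lambda,\lambda)$. Then $L$ has a balanced diagonal.
   Context: A frequency square of type $F(3\lambda;\lambda,\lambda,\lambda)$ is a $3\lambda\times 3\lambda$ array with entries from $\{1,2,3\}$ in which each of the three symbols occurs exactly $\lambda$ times in each row and exactly $\lambda$ times in each column. A diagonal of a square array is a set of cells that uses each row and each column exactly once. A diagonal of such a frequency square is balanced if each of the symbols $1,2,3$ occurs in exactly $\lambda$ of its cells. *)

(* Defs.v *)
From mathcomp Require Import all_boot all_order all_algebra.
Set Implicit Arguments.
Unset Strict Implicit.
Unset Printing Implicit Defensive.

(* The symbols 1, 2, 3 are represented by the elements 0, 1, 2 of 'I_3. *)
Definition frequency_square (lambda : nat)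
    (L : 'M['I_3]_(3 * lambda)) : Prop :=
  (forall (i : 'I_(3 * lambda)) (s : 'I_3),
      #|[set j : 'I_(3 * lambda) | L i j == s]| = lambda) /\
  (forall (j : 'I_(3 * lambda)) (s : 'I_3),
      #|[set i : 'I_(3 * lambda) | L i j == s]| = lambda).

(* A cell is a pair (row, column). *)
Definition diagonal (n : nat) (D : {set 'I_n * 'I_n}) : Prop :=
  (forall i : 'I_n, #|[set c in D | c.1 == i]| = 1) /\
  (forall j : 'I_n, #|[set c in D | c.2 == j]| = 1).

Definition balanced (lambda : nat) (L : 'M['I_3]_(3 * lambda))
    (D : {set 'I_(3 * lambda) * 'I_(3 * lambda)}) : Prop :=
  forall s : 'I_3, #|[set c in D | L c.1 c.2 == s]| = lambda.

(* Main.v *)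
Require Import Defs.
From mathcomp Require Import all_boot all_order all_algebra.
From mathcomp Require Import zify.

(** The proof is by induction on [lambda]. Call a 3x3 subarray a gadget if, for some colour [z],
    it has a diagonal with each of the three multisets obtained from [{x, y, z, z}] by deleting one
    colour, where [x], [y] are the other two colours.

    Without a gadget, a finite search over the possible column types shows that if three rows have
    three different colours in some column, then one of them is a translate mod 3 of another one,
    which in turn is everywhere different from the third. A counting argument then produces three
    rows that are pairwise different in every column, and three such columns by transposition. They
    meet in a Latin square of order 3, which has a diagonal with one cell of each colour; deleting
    the six lines leaves a smaller frequency square.

    With a gadget, let [R] be the array left after deleting its lines. If [R] has a partial diagonal
    missing one row and one column, with one [z]-cell less than the other colours, then whatever the
    colour of the last cell of [R] is, a suitable diagonal of the gadget completes a balanced one.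
    For [lambda >= 3] such a partial diagonal exists: fix the [z]-cells [K] of it; the numbers of
    [x]-cells in the completions of [K] by non-[z] cells form an interval, and if this interval always
    missed the right value it would lie on the same side of it for all [K], which is refuted by
    Koenig's theorem. For [lambda = 2] the only bad [R] are the arrays all of whose cells off
    one row and one column are [z], and these are handled by hand. *)

(** Exchanging cells of a diagonal moves several colour counts at once. Once the [z]-cells [K] are
    fixed, the other cells have two colours and their number is fixed, so a single count decides,
    and exchanges that change it by at most one give an intermediate value argument. This needs
    room: with [lambda = k + 2] the array [R] has order [3 * k + 3], the [k] cells of [K] leave
    order [2 * k + 3], and a line with at most [k + 2] cells [z] keeps [k + 1] others, just enough.
    Long one-coloured matchings exist because each colour has more than [3 * k * (k + 2)] cells in
    [R], too many for [3 * k] lines. To pass from one [K] to another without changing sides, [K] is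
    enlarged by one [z]-cell so that a single completion serves both; what can prevent this is a
    large all-[z] rectangle.

    The Latin triples are pairwise different along the whole array, not only in their 3x3 block:
    deleting them lowers every colour count of every remaining line by exactly one, so the induction
    stays within frequency squares. *)

Set Implicit Arguments.
Unset Strict Implicit.
Unset Printing Implicit Defensive.

(* Naming the canonical [finType] avoids a [reverse_coercion] in the elaborated type, which
   blocks rewriting and [lia]. *)
Notation cells P Q := {set Datatypes_prod__canonical__fintype_Finite P Q}.

(** * Matchings in a bipartite graph *)

Section Matchings.

Variables P Q : finType.
Implicit Types (M N E : cells P Q) (c d e : P * Q).

Definition conflict c d := (c.1 == d.1) || (c.2 == d.2).

Definition matching M := [forall c in M, forall d in M, conflict c d ==> (c == d)].

Definition rows M : {set P} := [set c.1 | c in M].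
Definition cols M : {set Q} := [set c.2 | c in M].

Lemma matchingP M :
  reflect {in M &, forall c d, conflict c d -> c = d} (matching M).
Proof.
apply: (iffP forall_inP) => [H c d cM dM cd|H c cM].
  by have /forall_inP/(_ _ dM)/implyP/(_ cd)/eqP := H _ cM.
by apply/forall_inP => d dM; apply/implyP => cd; apply/eqP; apply: H.
Qed.

Lemma conflict_sym c d : conflict c d = conflict d c.
Proof. by rewrite /conflict ![_ == d.1]eq_sym ![_ == d.2]eq_sym. Qed.

Lemma matchingS M N : M \subset N -> matching N -> matching M.
Proof.
move=> /subsetP MN /matchingP H; apply/matchingP => c d cM dM.
by apply: H; apply: MN.
Qed.

Lemma matching0 : matching set0.
Proof. by apply/matchingP => c d; rewrite inE. Qed.

Lemma matchingU M N : matching M -> matching N ->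
  {in M & N, forall c d, ~~ conflict c d} -> matching (M :|: N).
Proof.
move=> /matchingP HM /matchingP HN H; apply/matchingP => c d.
rewrite !inE => /orP[cM|cN] /orP[dM|dN] cd; try by [apply: HM|apply: HN].
  by have := H _ _ cM dN; rewrite cd.
by have := H _ _ dM cN; rewrite conflict_sym cd.
Qed.

Lemma matching1 c : matching [set c].
Proof. by apply/matchingP => d e; rewrite !inE => /eqP-> /eqP->. Qed.

Lemma mem_rows M c : c \in M -> c.1 \in rows M.
Proof. by move=> cM; apply/imsetP; exists c. Qed.

Lemma mem_cols M c : c \in M -> c.2 \in cols M.
Proof. by move=> cM; apply/imsetP; exists c. Qed.

Lemma matching_setU1 M c : matching M ->
  {in M, forall d, ~~ conflict c d} -> matching (c |: M).
Proof.
move=> mM H; apply: matchingU => //; first exact: matching1.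
by move=> d e; rewrite inE => /eqP->; apply: H.
Qed.

Lemma matching_add M p q : matching M -> p \notin rows M -> q \notin cols M ->
  matching ((p, q) |: M).
Proof.
move=> mM pM qM; apply: matching_setU1 => // d dM.
rewrite /conflict /= negb_or; apply/andP; split; apply/eqP => E.
  by rewrite E mem_rows in pM.
by rewrite E mem_cols in qM.
Qed.

Lemma card_rows M : matching M -> #|rows M| = #|M|.
Proof.
move=> /matchingP mM; rewrite card_in_imset // => c d cM dM E.
by apply: mM => //; rewrite /conflict E eqxx.
Qed.

Lemma card_cols M : matching M -> #|cols M| = #|M|.
Proof.
move=> /matchingP mM; rewrite card_in_imset // => c d cM dM E.
by apply: mM => //; rewrite /conflict E eqxx orbT.
Qed.

Lemma rowsU M N : rows (M :|: N) = rows M :|: rows N.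
Proof. exact: imsetU. Qed.

Lemma colsU M N : cols (M :|: N) = cols M :|: cols N.
Proof. exact: imsetU. Qed.

Lemma rowsU1 c M : rows (c |: M) = c.1 |: rows M.
Proof. by rewrite rowsU /rows imset_set1. Qed.

Lemma colsU1 c M : cols (c |: M) = c.2 |: cols M.
Proof. by rewrite colsU /cols imset_set1. Qed.

Lemma rowsS M N : M \subset N -> rows M \subset rows N.
Proof. exact: imsetS. Qed.

Lemma colsS M N : M \subset N -> cols M \subset cols N.
Proof. exact: imsetS. Qed.

Lemma rowsD1 M c : matching M -> c \in M -> rows (M :\ c) = rows M :\ c.1.
Proof.
move=> /matchingP mM cM; apply/setP => p; rewrite !inE; apply/imsetP/andP.
  case=> d; rewrite !inE => /andP[dc dM] ->; split; last exact: mem_rows.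
  by apply: contra dc => /eqP E; apply/eqP/mM => //; rewrite /conflict E eqxx.
case=> pc /imsetP[d dM E]; exists d; rewrite // !inE dM andbT.
by apply: contra pc => /eqP<-; rewrite E.
Qed.

Lemma colsD1 M c : matching M -> c \in M -> cols (M :\ c) = cols M :\ c.2.
Proof.
move=> /matchingP mM cM; apply/setP => p; rewrite !inE; apply/imsetP/andP.
  case=> d; rewrite !inE => /andP[dc dM] ->; split; last exact: mem_cols.
  by apply: contra dc => /eqP E; apply/eqP/mM => //; rewrite /conflict E eqxx orbT.
case=> pc /imsetP[d dM E]; exists d; rewrite // !inE dM andbT.
by apply: contra pc => /eqP<-; rewrite E.
Qed.

Lemma subset_of_card (T : finType) (A : {set T}) k :
  k <= #|A| -> exists2 B : {set T}, B \subset A & #|B| = k.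
Proof.
elim: k => [|k IH] kA; first by exists set0; rewrite ?sub0set ?cards0.
have [B BA Bk] := IH (ltnW kA).
have /set0Pn[a] : A :\: B != set0.
  by rewrite -card_gt0 cardsD (setIidPr BA) Bk subn_gt0.
rewrite inE => /andP[aB aA]; exists (a |: B); last by rewrite cardsU1 aB Bk.
by rewrite subUset sub1set aA.
Qed.

Definition cover (A : {set P}) (B : {set Q}) E :=
  [forall c in E, (c.1 \in A) || (c.2 \in B)].

(* Koenig's theorem, by Rado's argument: in an inclusion-minimal edge set with
   no small cover, two edges at a common row would yield two small covers, which
   uncross. *)
Lemma konig E k : (forall A B, cover A B E -> k <= #|A| + #|B|) ->
  exists M, [/\ M \subset E, matching M & #|M| = k].
Proof.
have [n] := ubnP #|E|; elim: n E => // n IH E En Ecov.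
pose tight E' := [forall A, forall B, cover A B E' ==> (k <= #|A| + #|B|)].
have tightP E' : reflect (forall A B, cover A B E' -> k <= #|A| + #|B|) (tight E').
  apply: (iffP forallP) => H A; first by move=> B; have /forallP/(_ B)/implyP := H A.
  by apply/forallP => B; apply/implyP; apply: H.
have [c0 /andP[cE /tightP H]|H] := pickP (fun c => (c \in E) && tight (E :\ c)).
  have [|M [ME mM Mk]] := IH (E :\ c0) _ H.
    by rewrite (cardsD1 c0 E) cE in En.
  by exists M; rewrite (subset_trans ME) ?subsetDl.
have rowE : {in E &, forall c d, c.1 = d.1 -> c = d}.
  move=> c d cE dE cd; apply/eqP/negPn/negP => ncd.
  have hcov e : e \in E -> exists A B, [/\ cover A B (E :\ e), #|A| + #|B| < k,
     e.1 \notin A & e.2 \notin B].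
    move=> eE; have := H e; rewrite eE /= => /negbT; rewrite negb_forall.
    case/existsP=> A; rewrite negb_forall => /existsP[B].
    rewrite negb_imply -ltnNge => /andP[cAB ltk]; exists A, B.
    suff /norP[eA eB] : ~~ ((e.1 \in A) || (e.2 \in B)) by [].
    apply/negP => eAB; suff /Ecov : cover A B E by rewrite leqNgt ltk.
    apply/forall_inP => d' d'E; have [->//|nde] := eqVneq d' e.
    by have /forall_inP := cAB; apply; rewrite !inE nde.
  have [A1 [B1 [cov1 lt1 cA1 cB1]]] := hcov _ cE.
  have [A2 [B2 [cov2 lt2 dA2 dB2]]] := hcov _ dE.
  have dB1 : d.2 \in B1.
    have /forall_inP/(_ d) := cov1; rewrite !inE eq_sym ncd dE => /(_ isT).
    by rewrite -cd (negPf cA1).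
  have cB2 : c.2 \in B2.
    have /forall_inP/(_ c) := cov2; rewrite !inE ncd cE => /(_ isT).
    by rewrite cd (negPf dA2).
  have covI : cover (A1 :&: A2) (B1 :|: B2) E.
    apply/forall_inP => e eE; rewrite !inE.
    have [->|nec] := eqVneq e c; first by rewrite cB2 !orbT.
    have [->|ned] := eqVneq e d; first by rewrite dB1 !orbT.
    have /forall_inP/(_ e) := cov1; rewrite !inE nec eE => /(_ isT).
    have /forall_inP/(_ e) := cov2; rewrite !inE ned eE => /(_ isT).
    by case: (e.1 \in A1); case: (e.1 \in A2); case: (e.2 \in B1); case: (e.2 \in B2).
  have covU : cover (c.1 |: (A1 :|: A2)) (B1 :&: B2) E.
    apply/forall_inP => e eE; rewrite !inE.
    have [->|nec] := eqVneq e c; first by rewrite eqxx.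
    have [->|ned] := eqVneq e d; first by rewrite cd eqxx.
    have /forall_inP/(_ e) := cov1; rewrite !inE nec eE => /(_ isT).
    have /forall_inP/(_ e) := cov2; rewrite !inE ned eE => /(_ isT).
    by case: (e.1 \in A1); case: (e.1 \in A2); case: (e.2 \in B1);
       case: (e.2 \in B2); rewrite ?orbT.
  have := Ecov _ _ covI; have := Ecov _ _ covU.
  have := cardsUI A1 A2; have := cardsUI B1 B2; rewrite cardsU1.
  by move: lt1 lt2; case: (_ \notin _) => /=; clear; lia.
(* Distinct cells of the minimal [E] lie in distinct rows, so keeping one cell per column gives a
   matching. The columns of [E] form a cover, so there are at least [k] of them. *)
pose M := [set c in E | [pick d in E | d.2 == c.2] == Some c].
have ME : M \subset E by apply/subsetP => c; rewrite inE => /andP[].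
have mM : matching M.
  apply/matchingP => c d; rewrite !inE => /andP[cE /eqP pc] /andP[dE /eqP pd].
  case/orP=> /eqP cd; first exact: rowE.
  by have := pc; rewrite cd pd => -[->].
have kM : k <= #|M|.
  rewrite -card_cols //; have -> : cols M = cols E.
    apply/eqP; rewrite eqEsubset colsS //=; apply/subsetP => q /imsetP[c cE ->].
    case E1: [pick d in E | d.2 == c.2] => [d|]; last first.
      by case: pickP E1 => // /(_ c); rewrite cE eqxx.
    have /andP[dE /eqP dc] : (d \in E) && (d.2 == c.2).
      by case: pickP E1 => // d' dP [<-].
    by rewrite -dc mem_cols // inE dE dc E1 /=.
  have := Ecov set0 (cols E); rewrite cards0; apply.
  by apply/forall_inP => c cE; rewrite mem_cols ?orbT.
have [N NM Nk] := subset_of_card kM.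
by exists N; rewrite (subset_trans NM) // (matchingS NM).
Qed.

End Matchings.

(** * Exchanges between matchings, and intermediate values for near-perfect matchings *)

Section Exchange.

Variables P Q : finType.
Implicit Types (M N E : cells P Q) (c d e : P * Q).

Lemma cardD_eq (T : finType) (A B : {set T}) :
  #|A| = #|B| -> #|A :\: B| = #|B :\: A|.
Proof. by move=> AB; rewrite !cardsD AB setIC. Qed.

Lemma card_swap (T : finType) (A : {set T}) a b :
  a \in A -> b \notin A -> #|b |: A :\ a| = #|A|.
Proof. by move=> aA bA; rewrite cardsU1 !inE (negPf bA) andbF (cardsD1 a A) aA. Qed.

Lemma count_swap (T : finType) (g : pred T) (A : {set T}) a b :
  a \in A -> b \notin A ->
  #|[set c in b |: A :\ a | g c]| + g a = #|[set c in A | g c]| + g b.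
Proof.
move=> aA bA; rewrite (cardsD1 b [set c in b |: A :\ a | g c]).
rewrite (cardsD1 a [set c in A | g c]) !inE eqxx aA /=.
suff -> : [set c in b |: A :\ a | g c] :\ b = [set c in A | g c] :\ a.
  by rewrite addnC addnA addnAC.
apply/setP => c; rewrite !inE.
have [->|cb] /= := eqVneq c b; first by rewrite (negPf bA) andbF.
by rewrite andbA.
Qed.

Lemma matching_swap M c e : matching M ->
  {in M, forall d, d != e -> ~~ conflict c d} -> matching (c |: M :\ e).
Proof.
move=> mM H; apply: matching_setU1 (matchingS (subD1set _ _) mM) _ => d.
by rewrite !inE => /andP[de dM]; apply: H.
Qed.

(** A cell whose row or column is missed by [M] conflicts with at most one cell of [M], and that
    cell is not in [N], since [N] is a matching containing [c]. If there is no conflict, any cell of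
    [M :\: N] may go; one exists because the sizes agree and [c] is not in [M]. *)
Lemma exchange M N c : matching M -> matching N -> #|M| = #|N| ->
  c \in N -> (c.1 \notin rows M) || (c.2 \notin cols M) ->
  exists2 e, e \in M :\: N & matching (c |: M :\ e).
Proof.
move=> mM mN MN cN free; have /matchingP mM' := mM; have /matchingP mN' := mN.
have cM : c \notin M.
  by apply/negP => cM; rewrite mem_rows ?mem_cols in free.
have [e /andP[eM ce]|noc] := pickP (fun e => (e \in M) && conflict c e).
  exists e; first rewrite inE eM andbT.
    by apply: contra cM => eN; rewrite (mN' c e).
  apply: matching_swap => // d dM; apply: contra => cd; apply/eqP/mM' => //.
  case/orP: free => [cr|cc].
    have nc1 d' : d' \in M -> (c.1 == d'.1) = false.
      by move=> d'M; apply: contraNF cr => /eqP->; apply: mem_rows.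
    move: ce cd; rewrite /conflict nc1 // nc1 //= => /eqP<- /eqP<-.
    by rewrite eqxx orbT.
  have nc2 d' : d' \in M -> (c.2 == d'.2) = false.
    by move=> d'M; apply: contraNF cc => /eqP->; apply: mem_cols.
  move: ce cd; rewrite /conflict nc2 // nc2 // !orbF => /eqP<- /eqP<-.
  by rewrite eqxx.
have : 0 < #|M :\: N|.
  by rewrite (cardD_eq MN) card_gt0; apply/set0Pn; exists c; rewrite inE cM.
rewrite card_gt0 => /set0Pn[e eMN]; exists e => //.
by apply: matching_swap => // d dM _; have := noc d; rewrite dM /= => ->.
Qed.

Lemma diff_exchange M N c e : e \in M :\: N -> c \in N ->
  #|(c |: M :\ e) :\: N| < #|M :\: N|.
Proof.
move=> eMN cN; rewrite [X in _ < X](cardsD1 e) eMN ltnS subset_leq_card //.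
apply/subsetP => d; rewrite !inE => /andP[dN /orP[/eqP dc|/andP[de dM]]].
  by rewrite dc cN in dN.
by rewrite de dN.
Qed.

(* Two matchings avoiding the same row [r] and the same column [q] can both take
   the edge [(r, q)]. *)
Lemma exchange_both M N r q : matching M -> matching N -> #|M| = #|N| -> M != N ->
  r \notin rows M -> r \notin rows N -> q \notin cols M -> q \notin cols N ->
  exists e e', [/\ e \in M :\: N, e' \in N :\: M,
    matching ((r, q) |: M :\ e), matching ((r, q) |: N :\ e') &
    #|((r, q) |: M :\ e) :\: ((r, q) |: N :\ e')| < #|M :\: N| ].
Proof.
move=> mM mN MN neq rM rN qM qN.
have dMN : 0 < #|M :\: N|.
  rewrite card_gt0; apply: contra neq; rewrite setD_eq0 => sMN.
  by rewrite eqEcard sMN MN /=.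
have dNM : 0 < #|N :\: M| by rewrite -(cardD_eq MN).
move: (dMN) dNM; rewrite !card_gt0 => /set0Pn[e eMN] /set0Pn[e' eNM].
have sw L d : matching L -> r \notin rows L -> q \notin cols L -> matching ((r, q) |: L :\ d).
  move=> mL rL qL; apply: (@matchingS _ _ _ ((r, q) |: L)).
    by apply: setUS; apply: subD1set.
  exact: matching_add.
exists e, e'; split; rewrite ?sw //.
rewrite [X in _ < X](cardsD1 e) eMN ltnS subset_leq_card //.
apply/subsetP => d; rewrite !inE !negb_or negb_and !negbK.
case/andP=> /andP[/negPf-> /= dN] /andP[-> dM]; rewrite dM andbT.
by case/orP: dN => // /eqP E; move: eNM; rewrite -E inE dM.
Qed.

End Exchange.

Section Interval.

Variables P Q : finType.
Variables (A : {set P}) (B : {set Q}) (E : cells P Q) (g : pred (P * Q)) (j t : nat).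
Hypothesis EAB : E \subset setX A B.
Hypotheses (cA : #|A| = j.*2.+1) (cB : #|B| = j.*2.+1).
Hypothesis degA : forall p, p \in A -> j <= #|[set q | (p, q) \in E]|.
Hypothesis degB : forall q, q \in B -> j <= #|[set p | (p, q) \in E]|.

Implicit Types (M N : cells P Q).

Definition near M := [&& matching M, M \subset E & #|M| == j.*2].

Definition wt M := #|[set c in M | g c]|.

Lemma near_swap M c e : near M -> e \in M -> c \in E -> c \notin M ->
  matching (c |: M :\ e) -> near (c |: M :\ e).
Proof.
case/and3P=> mM ME /eqP Mj eM cE cM mc; rewrite /near mc card_swap // Mj eqxx andbT /=.
by rewrite subUset sub1set cE (subset_trans (subD1set _ _)).
Qed.

Lemma wt_swap M c e : e \in M -> c \notin M ->
  wt (c |: M :\ e) <= (wt M).+1 /\ wt M <= (wt (c |: M :\ e)).+1.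
Proof.
move=> eM cM; have := count_swap g eM cM; rewrite /wt.
move: #|_| #|_| => u v.
by case: (g c); case: (g e); lia.
Qed.

Lemma near_hole M : near M -> exists r q, [/\ r \in A, q \in B, r \notin rows M, q \notin cols M &
  (forall p, p \in A -> p != r -> p \in rows M) /\ (forall p, p \in B -> p != q -> p \in cols M)].
Proof.
case/and3P=> mM /subset_trans/(_ EAB)/subsetP ME /eqP Mj.
have hole (T : finType) (X Y : {set T}) : Y \subset X -> #|X| = #|Y|.+1 ->
    exists r, [/\ r \in X, r \notin Y & forall p, p \in X -> p != r -> p \in Y].
  move=> YX cXY; have /cards1P[r Er] : #|X :\: Y| == 1.
    by rewrite cardsD (setIidPr YX) cXY subSnn.
  have : r \in X :\: Y by rewrite Er set11.
  rewrite inE => /andP[rY rX]; exists r; split=> // p pX.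
  by apply: contraNT => pY; rewrite -in_set1 -Er inE pY.
have [||r [rA rM rU]] := hole _ A (rows M).
- by apply/subsetP => _ /imsetP[c /ME + ->]; rewrite inE => /andP[].
- by rewrite card_rows // Mj.
have [||q [qB qM qU]] := hole _ B (cols M).
- by apply/subsetP => _ /imsetP[c /ME + ->]; rewrite inE => /andP[].
- by rewrite card_cols // Mj.
by exists r, q.
Qed.

(** Induction on [#|M :\: N|]; an exchange changes [wt] by at most one. If a cell of [N] meets a
    line missed by [M], an exchange brings [M] closer to [N] ([step]). Otherwise both matchings miss
    the same row [r] and column [q]; if [(r, q)] is in [E], both take it ([close]). If not, the
    degree bounds allow moving the hole, of [M] alone ([slide]) or of both matchings, to a place
    where [step] or [close] applies. *)
Lemma near_interval M N : near M -> near N -> wt N <= t <= wt M ->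
  exists2 L, near L & wt L = t.
Proof.
have [n] := ubnP #|M :\: N|; elim: n M N => // n IH M N; rewrite ltnS => Mn nM nN.
have [<-|wM] := eqVneq (wt M) t; first by exists M.
have [<-|wN] := eqVneq (wt N) t; first by exists N.
case/andP=> leN leM.
have {leN wN} ltN : wt N < t by rewrite ltn_neqAle wN.
have {leM wM} ltM : t < wt M by rewrite ltn_neqAle eq_sym wM.
have neqMN : M != N by apply: contraTneq ltN => <-; rewrite -leqNgt ltnW.
have [/and3P[mM ME /eqP Mj] /and3P[mN NE /eqP Nj]] := (nM, nN).
have cMN : #|M| = #|N| by rewrite Mj.
have step M' c : near M' -> t <= wt M' -> #|M' :\: N| <= n -> c \in N ->
    (c.1 \notin rows M') || (c.2 \notin cols M') -> exists2 L, near L & wt L = t.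
  move=> nM' wM' leM' cN free.
  have [E1|wM''] := eqVneq (wt M') t; first by exists M'.
  have /and3P[mM' _ /eqP M'j] := nM'.
  have [|e eM' mc] := exchange mM' mN _ cN free; first by rewrite M'j.
  have cM' : c \notin M'.
    by apply/negP => cM'; rewrite mem_rows ?mem_cols in free.
  have eM'1 : e \in M' by case/setDP: eM'.
  apply: (IH (c |: M' :\ e) N) => //.
  - exact: leq_trans (diff_exchange eM' cN) leM'.
  - by apply: near_swap => //; apply: (subsetP NE).
  - by have := wt_swap eM'1 cM'; move: wM' wM'' ltN; move: (wt N) (wt M') (wt _); clear; lia.
have close M' N' r q : near M' -> near N' -> wt N' <= t <= wt M' -> #|M' :\: N'| <= n ->
    M' != N' -> r \notin rows M' -> r \notin rows N' -> q \notin cols M' -> q \notin cols N' ->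
    (r, q) \in E -> exists2 L, near L & wt L = t.
  move=> nM' nN' /andP[wN' wM'] leM' neq rM rN qM qN rqE.
  have [<-|wM''] := eqVneq (wt M') t; first by exists M'.
  have [<-|wN''] := eqVneq (wt N') t; first by exists N'.
  have [/and3P[mM' _ /eqP M'j] /and3P[mN' _ /eqP N'j]] := (nM', nN').
  have [|e [e' [/setDP[eM _] /setDP[eN _] m1 m2 lt12]]] := exchange_both mM' mN' _ neq rM rN qM qN.
    by rewrite M'j.
  have rqM : (r, q) \notin M' by apply: contra rM; apply: mem_rows.
  have rqN : (r, q) \notin N' by apply: contra rN; apply: mem_rows.
  apply: (IH _ _ (leq_trans lt12 leM')); [exact: near_swap|exact: near_swap|].
  have := wt_swap eM rqM; have := wt_swap eN rqN.
  by move: wM' wM'' wN' wN''; move: (wt M') (wt N') (wt _) (wt _); clear; lia.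
have [r [q [rA qB rM qM [rU qU]]]] := near_hole nM.
have rows_eq : {in N, forall c, c.1 \in rows M} -> rows N = rows M.
  move=> H.
  apply/eqP; rewrite eqEcard !card_rows // cMN leqnn andbT.
  by apply/subsetP => _ /imsetP[c cN ->]; apply: H.
have cols_eq : {in N, forall c, c.2 \in cols M} -> cols N = cols M.
  move=> H.
  apply/eqP; rewrite eqEcard !card_cols // cMN leqnn andbT.
  by apply/subsetP => _ /imsetP[c cN ->]; apply: H.
have [c /andP[cN free]|nofree] :=
    pickP (fun c => (c \in N) && ((c.1 \notin rows M) || (c.2 \notin cols M))).
  by apply: (step M c) => //; apply: ltnW.
have Nrow c : c \in N -> c.1 \in rows M.
  by move=> cN; have := nofree c; rewrite cN /= => /negbT; rewrite negb_or negbK => /andP[].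
have Ncol c : c \in N -> c.2 \in cols M.
  by move=> cN; have := nofree c; rewrite cN /= => /negbT; rewrite negb_or !negbK => /andP[].
have {rows_eq Nrow} Erow := rows_eq Nrow; have {cols_eq Ncol} Ecol := cols_eq Ncol.
have rN : r \notin rows N by rewrite Erow.
have qN : q \notin cols N by rewrite Ecol.
have [rqE|rqE] := boolP ((r, q) \in E).
  by apply: (close M N r q) => //; rewrite (ltnW ltN) (ltnW ltM).
have mM' := matchingP _ mM.
(* Trading [e] for [c] moves the hole of [M] onto a line used by [N] without increasing
   [#|M :\: N|], and [step] then gains. As [wt M] exceeds [t], the weight stays at least [t]. *)
have slide c e : e \in M :\: N -> c \in E -> c \notin N -> c \notin M ->
    matching (c |: M :\ e) ->
    (exists2 d, d \in N & (d.1 \notin rows (c |: M :\ e)) || (d.2 \notin cols (c |: M :\ e))) ->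
    exists2 L, near L & wt L = t.
  move=> eMN cE cN cM mc [d dN free]; have /setDP[eM eN] := eMN.
  apply: (step (c |: M :\ e) d) => //; first exact: near_swap.
    by have := wt_swap eM cM; move: ltM; move: (wt M) (wt _); clear; lia.
  apply: leq_trans Mn; rewrite -(@card_swap _ (M :\: N) e c) ?inE ?(negPf cM) ?andbF //.
    apply: subset_leq_card; apply/subsetP => d'; rewrite !inE.
    by case: (d' == c) => //=; case: (d' == e); rewrite ?andbF.
  by rewrite eN.
have [[a b] /andP[abMN arb]|norow] := pickP (fun e => (e \in M :\: N) && ((r, e.2) \in E)).
  have /setDP[abM abN] := abMN; rewrite /= in arb.
  apply: (slide (r, b) (a, b)) => //.
  - by apply: contra rN; apply: mem_rows.
  - by apply: contra rM; apply: mem_rows.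
  - apply: matching_swap => // -[a' b'] dM; apply: contra; rewrite /conflict /=.
    case/orP=> /eqP Ed; first by move: rM; rewrite Ed (mem_rows dM).
    by apply/eqP/mM' => //; rewrite /conflict /= Ed eqxx orbT.
  - have /imsetP[[a' b'] dN /= Ea] : a \in rows N by rewrite Erow; apply: (mem_rows abM).
    exists (a', b') => //=; rewrite rowsU1 rowsD1 // !inE /= -Ea eqxx /= orbF.
    by apply/orP; left; apply: contraNneq rM => <-; apply: (mem_rows abM).
have [[a b] /andP[abMN arb]|nocol] := pickP (fun e => (e \in M :\: N) && ((e.1, q) \in E)).
  have /setDP[abM abN] := abMN; rewrite /= in arb.
  apply: (slide (a, q) (a, b)) => //.
  - by apply: contra qN; apply: mem_cols.
  - by apply: contra qM; apply: mem_cols.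
  - apply: matching_swap => // -[a' b'] dM; apply: contra; rewrite /conflict /=.
    case/orP=> /eqP Ed; last by move: qM; rewrite Ed (mem_cols dM).
    by apply/eqP/mM' => //; rewrite /conflict /= Ed eqxx.
  - have /imsetP[[a' b'] dN /= Ea] : b \in cols N by rewrite Ecol; apply: (mem_cols abM).
    exists (a', b') => //=; apply/orP; right; rewrite colsU1 colsD1 // !inE /= -Ea eqxx /= orbF.
    by apply: contraNneq qM => <-; apply: (mem_cols abM).
(* The edges of [M] meeting a neighbour of [r] or of [q] all lie in [N], and
   there are too few common edges for these two families to be disjoint. *)
pose E1 := [set e in M | (r, e.2) \in E]; pose E2 := [set e in M | (e.1, q) \in E].
have sEA e : e \in E -> (e.1 \in A) && (e.2 \in B).
  by move=> /(subsetP EAB); rewrite inE.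
have leE1 : j <= #|E1|.
  apply: leq_trans (degA rA) _; rewrite -(@card_cols _ _ E1); last first.
    by apply: matchingS mM; apply/subsetP => e; rewrite inE => /andP[].
  apply: subset_leq_card; apply/subsetP => b; rewrite inE => rbE.
  have /imsetP[e eM Eb] : b \in cols M.
    apply: qU; first by have /andP[] := sEA _ rbE.
    by apply: contraNneq rqE => <-.
  by apply/imsetP; exists e; rewrite // inE eM -Eb.
have leE2 : j <= #|E2|.
  apply: leq_trans (degB qB) _; rewrite -(@card_rows _ _ E2); last first.
    by apply: matchingS mM; apply/subsetP => e; rewrite inE => /andP[].
  apply: subset_leq_card; apply/subsetP => a; rewrite inE => aqE.
  have /imsetP[e eM Ea] : a \in rows M.
    apply: rU; first by have /andP[] := sEA _ aqE.
    by apply: contraNneq rqE => <-.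
  by apply/imsetP; exists e; rewrite // inE eM -Ea.
have ltI : #|M :&: N| < j.*2.
  rewrite -Mj proper_card // properEneq subsetIl andbT.
  apply: contraNneq neqMN => /setIidPl sMN.
  by rewrite eqEcard sMN cMN /=.
have sU : E1 :|: E2 \subset M :&: N.
  apply/subsetP => e; rewrite inE => /orP[]; rewrite !inE => /andP[eM H]; rewrite eM /=.
    by apply/negPn/negP => eN; have := norow e; rewrite in_setD eN eM H.
  by apply/negPn/negP => eN; have := nocol e; rewrite in_setD eN eM H.
have : 0 < #|E1 :&: E2|.
  have := subset_leq_card sU; have := cardsUI E1 E2.
  by move: ltI leE1 leE2; clear; lia.
rewrite card_gt0 => /set0Pn[[a b]]; rewrite !inE /= => /andP[/andP[abM rbE] /andP[_ aqE]].
have abN : (a, b) \in N.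
  by have /subsetP/(_ (a, b)) := sU; rewrite !inE abM /= rbE => /(_ isT).
have mN' := matchingP _ mN.
have sl L : matching L -> {in L &, forall c d, conflict c d -> c = d} -> (a, b) \in L ->
    r \notin rows L -> matching ((r, b) |: L :\ (a, b)).
  move=> mL mL' abL rL; apply: matching_swap => // -[a' b'] dM; apply: contra; rewrite /conflict /=.
  case/orP=> /eqP Ed; first by move: rL; rewrite Ed (mem_rows dM).
  by apply/eqP/mL' => //; rewrite /conflict /= Ed eqxx orbT.
have rbM : (r, b) \notin M by apply: contra rM; apply: mem_rows.
have rbN : (r, b) \notin N by apply: contra rN; apply: mem_rows.
have ar : a != r by apply: contraNneq rM => <-; apply: (mem_rows abM).
have bq : q != b by apply: contraNneq qM => ->; apply: (mem_cols abM).
(* Both matchings trade their common cell [(a, b)] for [(r, b)]; the common hole moves to [(a, q)],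
   which is in [E]. *)
apply: (close ((r, b) |: M :\ (a, b)) ((r, b) |: N :\ (a, b)) a q) => //.
- exact: near_swap (sl _ _ _ _ _).
- exact: near_swap (sl _ _ _ _ _).
- by have := wt_swap abM rbM; have := wt_swap abN rbN; move: ltM ltN;
    move: (wt M) (wt N) (wt _) (wt _); clear; lia.
- apply: leq_trans Mn; apply: subset_leq_card; apply/subsetP => d; rewrite !inE.
  by case: (d == (r, b)) => //=; case: (d == (a, b)).
- apply: contraNneq neqMN => Eq; apply/eqP/setP => d; move/setP/(_ d): Eq; rewrite !inE.
  have [->|_] := eqVneq d (r, b); first by rewrite (negPf rbM) (negPf rbN).
  by have [->|_] := eqVneq d (a, b); rewrite ?abM ?abN.
- by rewrite rowsU1 rowsD1 // !inE /= eqxx orbF.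
- by rewrite rowsU1 rowsD1 // !inE /= eqxx orbF.
- by rewrite colsU1 colsD1 // !inE /= (negPf bq) (negPf qM).
- by rewrite colsU1 colsD1 // !inE /= (negPf bq) (negPf qN).
Qed.

End Interval.

Lemma I3_third (a b c d : 'I_3) : a != b -> a != c -> b != c ->
  d != a -> d != b -> d = c.
Proof.
move=> ab ac bc da db; apply/val_inj; move: ab ac bc da db; rewrite -!val_eqE /=.
by case: a b c d => [[|[|[|a]]] ?] [[|[|[|b]]] ?] [[|[|[|c]]] ?] [[|[|[|d]]] ?].
Qed.

Lemma card_rel (P Q : finType) (r : P -> Q -> bool) (A : {set P}) :
  #|[set c : P * Q | (c.1 \in A) && r c.1 c.2]| = \sum_(p in A) #|[set q | r p q]|.
Proof.
rewrite -sum1_card (eq_bigl (fun c : P * Q => (c.1 \in A) && r c.1 c.2)); last first.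
  by move=> c; rewrite inE.
rewrite -(pair_big_dep (mem A) r (fun _ _ => 1)) /=.
by apply: eq_bigr => p _; rewrite -sum1_card; apply: eq_bigl => q; rewrite inE.
Qed.

Lemma card_rel_rows (P Q : finType) (r : P -> Q -> bool) (A : {set P}) d :
  (forall p, p \in A -> #|[set q | r p q]| <= d) ->
  #|[set c : P * Q | (c.1 \in A) && r c.1 c.2]| <= #|A| * d.
Proof. by move=> H; rewrite card_rel -sum_nat_const leq_sum. Qed.

Lemma card_rel_swap (P Q : finType) (r : P -> Q -> bool) :
  #|[set c : P * Q | r c.1 c.2]| = #|[set c : Q * P | r c.2 c.1]|.
Proof.
rewrite -(card_imset [set c : Q * P | r c.2 c.1] (f := fun c => (c.2, c.1))); last first.
  by move=> [a b] [c d] [-> ->].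
apply: eq_card => -[p q]; rewrite inE /=; apply/idP/imsetP => [rpq|[[b a]]].
  by exists (q, p); rewrite ?inE.
by rewrite inE /= => rab [-> ->].
Qed.

Lemma card_rel_cols (P Q : finType) (r : P -> Q -> bool) (B : {set Q}) d :
  (forall q, q \in B -> #|[set p | r p q]| <= d) ->
  #|[set c : P * Q | (c.2 \in B) && r c.1 c.2]| <= #|B| * d.
Proof.
move=> H; rewrite (card_rel_swap (fun p q => (q \in B) && r p q)).
exact: (card_rel_rows (r := fun q p => r p q)).
Qed.

(** * Partial diagonals of the array outside a gadget *)

Section Rest.

Variables (P Q : finType) (f : P -> Q -> 'I_3) (k : nat) (z : 'I_3).
Hypotheses (cP : #|P| = 3 * k + 3) (cQ : #|Q| = 3 * k + 3).
Hypothesis degP : forall p (s : 'I_3), #|[set q | f p q == s]| <= k.+2.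
Hypothesis degQ : forall q (s : 'I_3), #|[set p | f p q == s]| <= k.+2.
(** With [lambda = k.+2], removing three rows and three columns leaves [3 * lambda * lambda - 6 *
    lambda = 3 * k * lambda] cells of colour [s], plus the number of those inside the gadget, which
    are subtracted twice; a gadget contains every colour. *)
Hypothesis total : forall s : 'I_3, 3 * k * k + 6 * k < #|[set c : P * Q | f c.1 c.2 == s]|.

Implicit Types (K M N T W X : cells P Q) (s : 'I_3).

Definition mono s n M :=
  [&& matching M, M \subset [set c | f c.1 c.2 == s] & #|M| == n].

Definition free K : cells P Q := [set c | (c.1 \notin rows K) && (c.2 \notin cols K)].

Definition nonz (A : {set P}) (B : {set Q}) : cells P Q :=
  [set c in setX A B | f c.1 c.2 != z].

Definition edges K := nonz (~: rows K) (~: cols K).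

Definition cnt s N := #|[set c in N | f c.1 c.2 == s]|.

(** If [K] has [k] cells, [2 * k + 3] rows and columns are left, and the [2 * k + 2] cells of [N]
    miss exactly one of each. *)
Definition nearK K N := near (edges K) k.+1 N.

Definition exact := exists K N, [/\ mono z k K, nearK K N &
  forall s, s != z -> cnt s N = k.+1].

Definition high s K := exists2 N, nearK K N & k.+1 <= cnt s N.

Definition allz (A : {set P}) (B : {set Q}) :=
  forall p q, p \in A -> q \in B -> f p q = z.

Lemma card_color_cover s (A : {set P}) (B : {set Q}) :
  #|[set c : P * Q | ((c.1 \in A) || (c.2 \in B)) && (f c.1 c.2 == s)]|
    <= (#|A| + #|B|) * k.+2.
Proof.
rewrite mulnDl.
have le1 := @card_rel_rows P Q (fun p q => f p q == s) A k.+2 (fun p _ => degP p s).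
have le2 := @card_rel_cols P Q (fun p q => f p q == s) B k.+2 (fun q _ => degQ q s).
apply: leq_trans (leq_add le1 le2).
apply: leq_trans (leq_card_setU _ _); apply: subset_leq_card; apply/subsetP => c.
by rewrite !inE andb_orl.
Qed.

(** Koenig's theorem for the [s]-cells off [A] and [B]: a cover by fewer than [n] lines, joined with
    [A] and [B], would cover all [s]-cells by [3 * k] lines with at most [k.+2] of them each,
    against [total]. *)
Lemma mono_exists s n (A : {set P}) (B : {set Q}) :
  #|A| + #|B| + n <= 3 * k + 1 ->
  exists2 X, mono s n X & {in X, forall c, (c.1 \notin A) && (c.2 \notin B)}.
Proof.
move=> le; pose E : cells P Q := [set c | [&& c.1 \notin A, c.2 \notin B & f c.1 c.2 == s]].
have [|X [XE mX Xn]] := @konig P Q E n.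
  move=> A' B' /forall_inP cov; rewrite leqNgt; apply/negP => lt.
  have sub : [set c : P * Q | f c.1 c.2 == s] \subset
      [set c | ((c.1 \in A :|: A') || (c.2 \in B :|: B')) && (f c.1 c.2 == s)].
    apply/subsetP => c; rewrite !inE => fc; rewrite fc andbT.
    have := cov c; rewrite inE fc; case: (c.1 \in A) => //=.
    by case: (c.2 \in B); rewrite ?orbT //= => /(_ isT).
  have le3 : (#|A :|: A'| + #|B :|: B'|) * k.+2 <= 3 * k * k.+2.
    rewrite leq_mul2r; apply/orP; right.
    have := leq_of_leqif (leq_card_setU A A'); have := leq_of_leqif (leq_card_setU B B').
    by move: le lt; clear; lia.
  have := leq_trans (total s) (leq_trans (subset_leq_card sub)
    (leq_trans (card_color_cover s _ _) le3)).
  by clear; lia.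
exists X; last first.
  by move=> c /(subsetP XE); rewrite inE => /and3P[-> ->].
rewrite /mono mX Xn eqxx andbT /=; apply: subset_trans XE _.
by apply/subsetP => c; rewrite !inE => /and3P[].
Qed.

(** The rectangle is what a cover of the non-[z] cells by fewer than [n] lines leaves uncovered. *)
Lemma block (A : {set P}) (B : {set Q}) n :
  (exists T, [/\ matching T, T \subset nonz A B & #|T| = n]) \/
  exists (A' : {set P}) (B' : {set Q}),
    [/\ A' \subset A, B' \subset B, allz A' B' & #|A| + #|B| < #|A'| + #|B'| + n].
Proof.
have [H|] := boolP [forall C, forall D, cover C D (nonz A B) ==> (n <= #|C| + #|D|)].
  left; have [|T [TE mT Tn]] := @konig P Q (nonz A B) n; last by exists T.
  by move=> C D cov; have /forallP/(_ D)/implyP := forallP H C; apply.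
rewrite negb_forall => /existsP[C]; rewrite negb_forall => /existsP[D].
rewrite negb_imply -ltnNge => /andP[/forall_inP cov lt]; right.
exists (A :\: C), (B :\: D); split; rewrite ?subsetDl //.
  move=> p q /setDP[pA pC] /setDP[qB qD]; apply/eqP; apply: contraNT pC => nz.
  have := cov (p, q); rewrite !inE /= pA qB nz /= => /(_ isT).
  by rewrite (negPf qD) orbF.
have := cardsID C A; have := cardsID D B.
have := subset_leq_card (subsetIr A C); have := subset_leq_card (subsetIr B D).
by move: lt; clear; lia.
Qed.

Lemma allz_rows (A : {set P}) (B : {set Q}) q : allz A B -> q \in B -> #|A| <= k.+2.
Proof.
move=> H qB; apply: leq_trans (degQ q z); apply: subset_leq_card; apply/subsetP => p pA.
by rewrite inE H.
Qed.

Lemma allz_cols (A : {set P}) (B : {set Q}) p : allz A B -> p \in A -> #|B| <= k.+2.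
Proof.
move=> H pA; apply: leq_trans (degP p z); apply: subset_leq_card; apply/subsetP => q qB.
by rewrite inE H.
Qed.

Lemma card_rest_rows K n : mono z n K -> #|~: rows K| = 3 * k + 3 - n.
Proof. by case/and3P=> mK _ /eqP Kn; rewrite cardsCs setCK card_rows // cP Kn. Qed.

Lemma card_rest_cols K n : mono z n K -> #|~: cols K| = 3 * k + 3 - n.
Proof. by case/and3P=> mK _ /eqP Kn; rewrite cardsCs setCK card_cols // cQ Kn. Qed.

(** Each remaining line has [2 * k + 3] cells, at most [k.+2] of them [z], hence at least [k.+1]
    usable ones: the degree bound of [near_interval]. *)
Lemma edges_interval s K M N : mono z k K -> nearK K M -> nearK K N ->
  cnt s N <= k.+1 <= cnt s M -> exists2 L, nearK K L & cnt s L = k.+1.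
Proof.
move=> mK; have cA := card_rest_rows mK; have cB := card_rest_cols mK.
apply: (@near_interval P Q (~: rows K) (~: cols K)).
- by apply/subsetP => c; rewrite inE => /andP[].
- by rewrite cA; clear; lia.
- by rewrite cB; clear; lia.
- move=> p pA.
  have := cardsID [set q | f p q == z] (~: cols K).
  have := subset_leq_card (subsetIr (~: cols K) [set q | f p q == z]).
  have := degP p z; rewrite cB.
  have -> : #|~: cols K :\: [set q | f p q == z]| = #|[set q | (p, q) \in edges K]|.
    apply: eq_card => q; move: pA; rewrite !inE /= => ->; by rewrite andbC.
  by clear; lia.
- move=> q qB.
  have := cardsID [set p | f p q == z] (~: rows K).
  have := subset_leq_card (subsetIr (~: rows K) [set p | f p q == z]).
  have := degQ q z; rewrite cA.
  have -> : #|~: rows K :\: [set p | f p q == z]| = #|[set p | (p, q) \in edges K]|.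
    apply: eq_card => p; move: qB; rewrite !inE /= => ->; by rewrite andbT andbC.
  by clear; lia.
Qed.

Lemma cnt_other s s' K N : nearK K N -> s != z -> s' != z -> s != s' ->
  cnt s N + cnt s' N = k.+1.*2.
Proof.
case/and3P=> mN /subsetP NE /eqP <- sz s'z ss'.
rewrite -(cardsID [set c | f c.1 c.2 == s] N) /cnt; congr (_ + _).
  by apply: eq_card => c; rewrite !inE.
apply: eq_card => c; rewrite !inE andbC; case cN: (c \in N); rewrite ?andbF ?andbT //.
have := NE c cN; rewrite !inE => /andP[_ cz].
apply/eqP/idP => [->|cs]; first by rewrite eq_sym.
by apply: (@I3_third z s s') => //; rewrite eq_sym.
Qed.

Lemma exact_of_cnt s K N : mono z k K -> nearK K N -> s != z -> cnt s N = k.+1 -> exact.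
Proof.
move=> mK nN sz cs; exists K, N; split=> // s' s'z.
have [<- //|ss'] := eqVneq s s'.
by have := cnt_other nN sz s'z ss'; rewrite cs; clear; lia.
Qed.

Lemma exact_of_high s s' K : mono z k K -> s != z -> s' != z -> s != s' ->
  high s K -> high s' K -> exact.
Proof.
move=> mK sz s'z ss' [M nM hM] [N nN hN].
have [|L nL] := @edges_interval s K M N mK nM nN.
  by have := cnt_other nN sz s'z ss'; move: hM hN; clear; lia.
exact: exact_of_cnt mK nL sz.
Qed.

Lemma exact_of_both s K N : mono z k K -> s != z -> high s K -> nearK K N ->
  cnt s N <= k.+1 -> exact.
Proof.
move=> mK sz [M nM hM] nN hN.
by have [|L nL] := @edges_interval s K M N mK nM nN; [rewrite hM hN|exact: exact_of_cnt mK nL sz].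
Qed.

Lemma mono_in_rest s K : mono z k K ->
  exists2 X, mono s k.+1 X & {in X, forall c, (c.1 \notin rows K) && (c.2 \notin cols K)}.
Proof.
case/and3P=> mK _ /eqP Kk; apply: mono_exists.
by rewrite card_rows // card_cols // Kk; clear; lia.
Qed.

(** [X] alone provides the required [s]-cells; [T0] only has to supply [k.+1] further non-[z] cells
    of any colour. *)
Lemma high_of_matching s K X T0 : s != z -> mono s k.+1 X ->
  {in X, forall c, (c.1 \notin rows K) && (c.2 \notin cols K)} ->
  matching T0 -> T0 \subset nonz (~: (rows K :|: rows X)) (~: (cols K :|: cols X)) ->
  k.+1 <= #|T0| -> high s K.
Proof.
move=> sz /and3P[mX /subsetP Xs /eqP Xk] XK mT0 T0E /subset_of_card[T TT0 Tk].
have mT := matchingS TT0 mT0; have /subsetP TE := subset_trans TT0 T0E.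
have XT : [disjoint X & T].
  rewrite disjoint_subset; apply/subsetP => c cX; rewrite !inE; apply/negP => /TE.
  by rewrite !inE (mem_rows cX) orbT.
exists (X :|: T).
  rewrite /nearK /near; apply/and3P; split.
  - apply: matchingU => // c d cX dT; have := TE _ dT; rewrite !inE !negb_or.
    case/andP=> /andP[/andP[_ dX1] /andP[_ dX2]] _;
    by apply/andP; split; [apply: contraNneq dX1 => <-; apply: mem_rows|
      apply: contraNneq dX2 => <-; apply: mem_cols].
  - apply/subsetP => c; rewrite inE => /orP[cX|/TE].
      have := XK _ cX; have := Xs _ cX; rewrite !inE => /eqP-> /andP[-> ->].
      by rewrite sz.
    by rewrite !inE !negb_or => /andP[/andP[/andP[-> _] /andP[-> _]] ->].
  - move: XT; rewrite -leq_card_setU => /eqP->.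
    by rewrite Xk Tk addnn.
rewrite -Xk; apply: subset_leq_card; apply/subsetP => c cX.
by have := Xs _ cX; rewrite !inE cX => ->.
Qed.

Lemma card_rest_rows2 s K X : mono z k K -> mono s k.+1 X ->
  {in X, forall c, (c.1 \notin rows K) && (c.2 \notin cols K)} ->
  #|~: (rows K :|: rows X)| = k.+2.
Proof.
case/and3P=> mK _ /eqP Kk /and3P[mX _ /eqP Xk] XK.
have d : [disjoint rows X & rows K].
  by rewrite disjoint_subset; apply/subsetP => _ /imsetP[c /XK/andP[cK _] ->].
move: d; rewrite cardsCs setCK setUC -leq_card_setU => /eqP->.
by rewrite !card_rows // cP Kk Xk; clear; lia.
Qed.

Lemma card_rest_cols2 s K X : mono z k K -> mono s k.+1 X ->
  {in X, forall c, (c.1 \notin rows K) && (c.2 \notin cols K)} ->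
  #|~: (cols K :|: cols X)| = k.+2.
Proof.
case/and3P=> mK _ /eqP Kk /and3P[mX _ /eqP Xk] XK.
have d : [disjoint cols X & cols K].
  by rewrite disjoint_subset; apply/subsetP => _ /imsetP[c /XK/andP[_ cK] ->].
move: d; rewrite cardsCs setCK setUC -leq_card_setU => /eqP->.
by rewrite !card_cols // cQ Kk Xk; clear; lia.
Qed.

(** A row common to [A'] and [A1] is [z] on [B1] and on [B'], and a row has at most [k.+2] cells
    [z]. *)
Lemma allz_row_split (A' A1 : {set P}) (B' B1 B2 : {set Q}) :
  [disjoint B1 & B2] -> allz A1 B1 -> allz A' B' ->
  0 < #|A' :&: A1| -> #|B1| + #|B' :&: B2| <= k.+2.
Proof.
move=> dB z1 zz; rewrite card_gt0 => /set0Pn[p /setIP[pA' pA1]].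
have d : [disjoint B1 & B' :&: B2].
  by apply: disjointWr dB; apply: subsetIr.
move: d; rewrite -leq_card_setU => /eqP<-.
apply: (@allz_cols [set p] _ p); rewrite ?set11 // => p' q /set1P-> /setUP[|/setIP[]] H //.
  exact: z1.
by move=> _; apply: zz.
Qed.

Lemma allz_col_split (A' A1 A2 : {set P}) (B' B1 : {set Q}) :
  [disjoint A1 & A2] -> allz A1 B1 -> allz A' B' ->
  0 < #|B' :&: B1| -> #|A1| + #|A' :&: A2| <= k.+2.
Proof.
move=> dA z1 zz; rewrite card_gt0 => /set0Pn[q /setIP[qB' qB1]].
have d : [disjoint A1 & A' :&: A2].
  by apply: disjointWr dA; apply: subsetIr.
move: d; rewrite -leq_card_setU => /eqP<-.
apply: (@allz_rows _ [set q] q); rewrite ?set11 // => p q' + /set1P->.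
by case/setUP=> [|/setIP[]] H; [apply: z1|move=> _; apply: zz].
Qed.

Lemma card_split_cover (T : finType) (A A1 A2 : {set T}) : [disjoint A1 & A2] ->
  A \subset A1 :|: A2 -> #|A| = #|A :&: A1| + #|A :&: A2|.
Proof.
move=> d sA; have : [disjoint A :&: A1 & A :&: A2].
  by apply: disjointWl (subsetIr _ _) (disjointWr (subsetIr _ _) d).
by rewrite -leq_card_setU => /eqP<-; rewrite -setIUr (setIidPl sA).
Qed.

Lemma card_avoid (T : finType) (A C D : {set T}) :
  A \subset ~: D -> D \subset C -> #|A :&: C| + #|D| <= #|C|.
Proof.
move=> AD DC; have : [disjoint A :&: C & D].
  by apply: disjointWl (subsetIl _ _) _; rewrite disjoint_subset; apply: subset_trans AD _;
     apply/subsetP => x; rewrite !inE.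
rewrite -leq_card_setU => /eqP<-; apply: subset_leq_card.
by rewrite subUset subsetIr.
Qed.

(** The [s]-cells [X] avoid both tiles. An all-[z] rectangle that obstructs the completion of [X]
    has more than [k + 3] lines. If it met rows of both tiles it would have at most one column,
    since these rows are already [z] on their tiles; likewise for columns. Inside one tile, [X] has
    used up [k.+1] of the [2 * k + 3] lines; inside one of the other two blocks, the bound on [z]
    leaves too few lines. *)
Lemma high_of_tiling s K (A1 A2 : {set P}) (B1 B2 : {set Q}) :
  0 < k -> mono z k K -> s != z ->
  A1 :|: A2 = ~: rows K -> B1 :|: B2 = ~: cols K ->
  [disjoint A1 & A2] -> [disjoint B1 & B2] -> allz A1 B1 -> allz A2 B2 ->
  #|A1| + #|B1| = 2 * k + 3 -> #|A2| + #|B2| = 2 * k + 3 ->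
  #|A1| <= k.+2 -> #|A2| <= k.+2 -> #|B1| <= k.+2 -> #|B2| <= k.+2 -> high s K.
Proof.
move=> k0 mK sz A12 B12 dA dB z1 z2 s1 s2 lA1 lA2 lB1 lB2.
have [X mX XK] := mono_in_rest s mK.
have /and3P[mtX /subsetP Xs /eqP Xk] := mX.
pose A := ~: (rows K :|: rows X); pose B := ~: (cols K :|: cols X).
have [[T0 [mT TE Tk]]|[A' [B' [AA BB zz lt]]]] := block A B k.+1.
  by apply: (high_of_matching sz mX XK mT TE); rewrite Tk.
exfalso.
pose X1 := [set c in X | c.1 \in A1]; pose X2 := X :\: X1.
have X2S : X2 \subset X by apply: subsetDl.
have X1S : X1 \subset X by apply/subsetP => c; rewrite inE => /andP[].
have cX12 : #|X1| + #|X2| = k.+1.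
  by rewrite -Xk -(cardsID X1 X) (setIidPr X1S).
have mX1 := matchingS X1S mtX; have mX2 := matchingS X2S mtX.
have Xz c : c \in X -> f c.1 c.2 <> z.
  by move=> /Xs; rewrite inE => /eqP-> E; rewrite E eqxx in sz.
have XA c : c \in X -> c.1 \notin A1 -> c.1 \in A2.
  by move=> /XK /andP[cK _] /negPf n1; have := in_setU c.1 A1 A2; rewrite n1 A12 inE cK.
have XB c : c \in X -> (c.2 \in B1) || (c.2 \in B2).
  by move=> /XK /andP[_ cK]; rewrite -in_setU B12 inE.
have rX1 : rows X1 \subset A1.
  by apply/subsetP => _ /imsetP[c + ->]; rewrite inE => /andP[].
have rX2 : rows X2 \subset A2.
  by apply/subsetP => _ /imsetP[c + ->]; rewrite !inE => /andP[+ cX]; rewrite cX; apply: XA.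
have cX1 : cols X1 \subset B2.
  apply/subsetP => _ /imsetP[c + ->]; rewrite inE => /andP[cX cA].
  by case/orP: (XB c cX) => // cB; case: (Xz c cX); apply: z1.
have cX2 : cols X2 \subset B1.
  apply/subsetP => _ /imsetP[c + ->]; rewrite !inE => /andP[+ cX]; rewrite cX => /(XA c cX) cA.
  by case/orP: (XB c cX) => // cB; case: (Xz c cX); apply: z2.
have avoidR (Y : cells P Q) : Y \subset X -> A' \subset ~: rows Y.
  move=> YX; apply: subset_trans AA _; rewrite setCS.
  by apply: subset_trans (rowsS YX) (subsetUr _ _).
have avoidC (Y : cells P Q) : Y \subset X -> B' \subset ~: cols Y.
  move=> YX; apply: subset_trans BB _; rewrite setCS.
  by apply: subset_trans (colsS YX) (subsetUr _ _).
have e1 := card_avoid (avoidR _ X1S) rX1; have e2 := card_avoid (avoidR _ X2S) rX2.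
have e3 := card_avoid (avoidC _ X1S) cX1; have e4 := card_avoid (avoidC _ X2S) cX2.
rewrite !card_rows // in e1 e2; rewrite !card_cols // in e3 e4.
have A'S : A' \subset A1 :|: A2.
  by rewrite A12; apply: subset_trans AA _; rewrite setCS subsetUl.
have B'S : B' \subset B1 :|: B2.
  by rewrite B12; apply: subset_trans BB _; rewrite setCS subsetUl.
have h1 := allz_row_split dB z1 zz; have h3 := allz_col_split dA z1 zz.
rewrite disjoint_sym in dA; rewrite disjoint_sym in dB.
have h2 := allz_row_split dB z2 zz; have h4 := allz_col_split dA z2 zz.
rewrite disjoint_sym in dA; rewrite disjoint_sym in dB.
have := subset_leq_card AA; have := subset_leq_card BB; move: lt.
rewrite (card_rest_rows2 mK mX XK) (card_rest_cols2 mK mX XK).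
rewrite (card_split_cover dA A'S) (card_split_cover dB B'S).
move: k0 cX12 e1 e2 e3 e4 h1 h2 h3 h4 s1 s2 lA1 lA2 lB1 lB2; clear; lia.
Qed.

(** Meant for a [W] with one [z]-cell more than needed: [N] fills all lines off [W], and is then a
    completion of [W :\ c] for every [c] in [W]. *)
Definition perfect W := exists N, [/\ matching N, N \subset edges W & #|N| = k.+1.*2].

Lemma other_colors : exists s s', [/\ s != z, s' != z & s != s'].
Proof.
have : #|[set~ z]| == 2 by rewrite cardsC1 card_ord.
by case/cards2P=> s [s' [ss' E]]; exists s, s'; rewrite -!in_setC1 E !inE !eqxx orbT.
Qed.

Lemma allz_nonempty (A : {set P}) (B : {set Q}) : allz A B ->
  #|A| <= 2 * k + 2 -> #|B| <= 2 * k + 2 -> 2 * k + 2 < #|A| + #|B| ->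
  [/\ 0 < #|A|, 0 < #|B|, #|A| <= k.+2 & #|B| <= k.+2].
Proof.
move=> zz lA lB lt.
have A0 : 0 < #|A| by move: lA lB lt; clear; lia.
have B0 : 0 < #|B| by move: lA lB lt; clear; lia.
have /set0Pn[p pA] : A != set0 by rewrite -card_gt0.
have /set0Pn[q qB] : B != set0 by rewrite -card_gt0.
by split=> //; [apply: allz_rows zz qB|apply: allz_cols zz pA].
Qed.

Lemma mono_add s n K p q : mono s n K -> p \notin rows K -> q \notin cols K ->
  f p q = s -> mono s n.+1 ((p, q) |: K).
Proof.
case/and3P=> mK Ks /eqP Kn pK qK fpq; rewrite /mono matching_add //.
rewrite cardsU1 Kn (contra (@mem_rows _ _ K (p, q)) pK) add1n eqxx andbT.
by rewrite subUset Ks sub1set inE /= fpq eqxx.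
Qed.

Lemma mono_del s n K c : mono s n.+1 K -> c \in K -> mono s n (K :\ c).
Proof.
case/and3P=> mK Ks /eqP Kn cK; rewrite /mono (matchingS _ mK) ?subsetDl //.
rewrite (subset_trans (subsetDl _ _) Ks) /=.
by move: Kn; rewrite (cardsD1 c K) cK add1n => -[->].
Qed.

(* A second large block of [z]'s would be disjoint from the first one, and the two
   would tile the remaining array. *)
Lemma perfect_of_block K (A1 : {set P}) (B1 : {set Q}) a b :
  0 < k -> ~ exact -> mono z k K -> A1 \subset ~: rows K -> B1 \subset ~: cols K ->
  allz A1 B1 -> 2 * k + 2 < #|A1| + #|B1| -> #|A1| <= k.+2 -> #|B1| <= k.+2 ->
  a \in A1 -> b \in B1 -> perfect ((a, b) |: K).
Proof.
move=> k0 nex mK A1S B1S z1 lt1 lA1 lB1 aA1 bB1.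
have aK : a \notin rows K by have := subsetP A1S _ aA1; rewrite inE.
have bK : b \notin cols K by have := subsetP B1S _ bB1; rewrite inE.
have mW := mono_add mK aK bK (z1 _ _ aA1 bB1).
have cR := card_rest_rows mW; have cC := card_rest_cols mW.
have [//|[A2 [B2 [A2S B2S z2]]]] := block (~: rows ((a, b) |: K)) (~: cols ((a, b) |: K)) k.+1.*2.
rewrite cR cC => lt2'; exfalso.
have lt2 : 2 * k + 2 < #|A2| + #|B2| by move: lt2'; clear; lia.
have [||A20 B20 lA2 lB2] := allz_nonempty z2 _ _ lt2.
- by have := subset_leq_card A2S; rewrite cR; clear; lia.
- by have := subset_leq_card B2S; rewrite cC; clear; lia.
have aA2 : a \notin A2.
  by apply/negP => /(subsetP A2S); rewrite rowsU1 !inE eqxx.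
have bB2 : b \notin B2.
  by apply/negP => /(subsetP B2S); rewrite colsU1 !inE eqxx.
have rowI p : p \in A1 -> p \in A2 -> #|B1 :|: B2| <= k.+2.
  move=> p1 p2; apply: (@allz_cols [set p] _ p); rewrite ?set11 // => _ q /set1P->.
  by case/setUP; [apply: z1|apply: z2].
have colI q : q \in B1 -> q \in B2 -> #|A1 :|: A2| <= k.+2.
  move=> q1 q2; apply: (@allz_rows _ [set q] q); rewrite ?set11 // => p _ + /set1P->.
  by case/setUP=> H; [apply: z1|apply: z2].
have ltA : #|A2| < #|A1 :|: A2|.
  by apply: proper_card; apply/properP; split; [apply: subsetUr|exists a; rewrite // inE aA1].
have ltB : #|B2| < #|B1 :|: B2|.
  by apply: proper_card; apply/properP; split; [apply: subsetUr|exists b; rewrite // inE bB1].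
(* If the two blocks share a row, the bound on [z] limits [B1 :|: B2] to [k.+2] columns, so they
   share a column too, and [A1 :|: A2] is limited in the same way. But the second block lacks row
   [a] and column [b], so it would be too small. *)
have rowD p : p \in A1 -> p \notin A2.
  move=> p1; apply/negP => p2; have leB := rowI p p1 p2.
  have : 0 < #|B1 :&: B2|.
    by have := cardsUI B1 B2; move: leB lt1 lt2 lA1 lA2 k0; clear; lia.
  rewrite card_gt0 => /set0Pn[q /setIP[q1 q2]]; have := colI q q1 q2.
  by move: ltA ltB leB lt2; clear; lia.
have colD q : q \in B1 -> q \notin B2.
  move=> q1; apply/negP => q2; have leA := colI q q1 q2.
  have : 0 < #|A1 :&: A2|.
    by have := cardsUI A1 A2; move: leA lt1 lt2 lB1 lB2 k0; clear; lia.
  by rewrite card_gt0 => /set0Pn[p /setIP[p1]]; apply/negP/rowD.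
have dA : [disjoint A1 & A2] by rewrite disjoint_subset; apply/subsetP => p /rowD.
have dB : [disjoint B1 & B2] by rewrite disjoint_subset; apply/subsetP => q /colD.
have sA : A1 :|: A2 \subset ~: rows K.
  rewrite subUset A1S (subset_trans A2S) // rowsU1 setCU; exact: subsetIr.
have sB : B1 :|: B2 \subset ~: cols K.
  rewrite subUset B1S (subset_trans B2S) // colsU1 setCU; exact: subsetIr.
have uA := dA; rewrite -leq_card_setU in uA; have {uA} uA := eqP uA.
have uB := dB; rewrite -leq_card_setU in uB; have {uB} uB := eqP uB.
have leA := subset_leq_card sA; have leB := subset_leq_card sB.
have cRK := card_rest_rows mK; have cCK := card_rest_cols mK.
have EA : A1 :|: A2 = ~: rows K.
  apply/eqP; rewrite eqEcard sA; move: leA leB; rewrite uA uB cRK cCK.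
  by move: lt1 lt2; clear; lia.
have EB : B1 :|: B2 = ~: cols K.
  apply/eqP; rewrite eqEcard sB; move: leA leB; rewrite uA uB cRK cCK.
  by move: lt1 lt2; clear; lia.
rewrite uA uB cRK cCK in leA leB.
have [s [s' [sz s'z ss']]] := other_colors.
apply: nex; apply: (exact_of_high mK sz s'z ss').
  by apply: (high_of_tiling k0 mK sz EA EB dA dB z1 z2) => //; move: lt1 lt2 leA leB; clear; lia.
by apply: (high_of_tiling k0 mK s'z EA EB dA dB z1 z2) => //; move: lt1 lt2 leA leB; clear; lia.
Qed.

(** The same [N] completes [W :\ c] and [W :\ d]. It has few [s]-cells because [W :\ d] is not high;
    if [W :\ c] were high, its interval of counts would contain the right value. *)
Lemma high_transfer s W c d : ~ exact -> s != z -> mono z k.+1 W -> perfect W ->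
  c \in W -> d \in W -> ~ high s (W :\ d) -> ~ high s (W :\ c).
Proof.
move=> nex sz mW [N [mN NE Nk]] cW dW low hi.
have nN e : nearK (W :\ e) N.
  rewrite /nearK /near mN Nk eqxx andbT /=; apply: subset_trans NE _.
  apply/subsetP => e'; rewrite !inE => /andP[/andP[r1 r2] ->]; rewrite andbT.
  by apply/andP; split; [apply: contra r1|apply: contra r2]; apply/subsetP;
    [apply: rowsS|apply: colsS]; apply: subsetDl.
apply: nex; apply: (exact_of_both (mono_del mW cW) sz hi (nN c)).
by rewrite leqNgt; apply/negP => lt; apply: low; exists N; rewrite // ltnW.
Qed.

(** Let [W] be [K] with [(i, j)] added. If [W] is perfect, [high_transfer] applies at once.
    Otherwise there is a large all-[z] block off [W]; for a cell [(a, b)] of it, adding [(a, b)] to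
    [K] or to the swapped set gives a perfect set by [perfect_of_block], and two transfers lead
    through [(a, b) |: K :\ c]. *)
Lemma high_swap s K c i j : 0 < k -> ~ exact -> s != z -> mono z k K -> c \in K ->
  i \notin rows K -> j \notin cols K -> f i j = z ->
  ~ high s K -> ~ high s ((i, j) |: K :\ c).
Proof.
move=> k0 nex sz mK cK iK jK fij low; pose W := (i, j) |: K.
have mW : mono z k.+1 W := mono_add mK iK jK fij.
have ijK : (i, j) \notin K by apply: contra iK; apply: mem_rows.
have del p q (L : cells P Q) : (p, q) \notin L -> ((p, q) |: L) :\ (p, q) = L by apply: setU1K.
have delc (p : P * Q) (L : cells P Q) : p != c -> (p |: L) :\ c = p |: L :\ c.
  by move=> pc; rewrite setDUl; congr (_ :|: _); apply/setDidPl; rewrite disjoints1 inE.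
have ijc : (i, j) != c by apply: contraNneq ijK => ->.
have [pW|[A1 [B1 [A1S B1S z1]]]] := block (~: rows W) (~: cols W) k.+1.*2.
  rewrite -delc //; apply: (@high_transfer s W c (i, j)) => //; rewrite ?inE ?eqxx ?cK ?orbT //.
  by rewrite del.
rewrite (card_rest_rows mW) (card_rest_cols mW) => lt'.
have lt1 : 2 * k + 2 < #|A1| + #|B1| by move: lt'; clear; lia.
have [||A10 B10 lA1 lB1] := allz_nonempty z1 _ _ lt1.
- by have := subset_leq_card A1S; rewrite (card_rest_rows mW); clear; lia.
- by have := subset_leq_card B1S; rewrite (card_rest_cols mW); clear; lia.
move: A10 B10; rewrite !card_gt0 => /set0Pn[a aA1] /set0Pn[b bB1].
have sub (L : cells P Q) : L \subset W -> (A1 \subset ~: rows L) * (B1 \subset ~: cols L).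
  by move=> LW; rewrite (subset_trans A1S) ?(subset_trans B1S) // setCS ?rowsS ?colsS.
have aW : a \notin rows W by have := subsetP A1S _ aA1; rewrite inE.
have bW : b \notin cols W by have := subsetP B1S _ bB1; rewrite inE.
have KW : K \subset W := subsetUr _ _.
have aK : a \notin rows K by apply: contra aW; apply/subsetP/rowsS.
have bK : b \notin cols K by apply: contra bW; apply/subsetP/colsS.
have abK : (a, b) \notin K by apply: contra aK; apply: mem_rows.
have abW : (a, b) \notin W by apply: contra aW; apply: mem_rows.
have abc : (a, b) != c by apply: contraNneq abK => ->.
have p1 : perfect ((a, b) |: K).
  by apply: (perfect_of_block k0 nex mK _ _ z1) => //; rewrite sub.
have low1 : ~ high s ((a, b) |: K :\ c).
  rewrite -delc //; apply: (@high_transfer s _ c (a, b)) => //.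
  - exact: mono_add (z1 _ _ aA1 bB1).
  - by rewrite !inE cK orbT.
  - by rewrite !inE eqxx.
  - by rewrite del.
have K1W : (i, j) |: K :\ c \subset W by apply: setUS; apply: subsetDl.
have mK1 : mono z k ((i, j) |: K :\ c).
  by rewrite -delc //; apply: mono_del mW _; rewrite !inE cK orbT.
have p2 : perfect ((a, b) |: ((i, j) |: K :\ c)).
  by apply: (perfect_of_block k0 nex mK1 _ _ z1) => //; rewrite sub.
have mW2 : mono z k.+1 ((a, b) |: ((i, j) |: K :\ c)).
  apply: mono_add (z1 _ _ aA1 bB1) => //.
    by apply: contra aW; apply/subsetP/rowsS.
  by apply: contra bW; apply/subsetP/colsS.
have abK1 : (a, b) \notin (i, j) |: K :\ c by apply: contra abW; apply/subsetP.
rewrite -(del a b ((i, j) |: K :\ c)) //.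
apply: (@high_transfer s _ (a, b) (i, j)) => //; rewrite ?inE ?eqxx ?orbT //.
rewrite setUCA del //; rewrite !inE (negPf ijK) andbF orbF.
by apply: contraNneq abW => <-; rewrite !inE eqxx.
Qed.

(** If [K0] is not high, a non-[z] matching [L] off [X] is grown cell by cell up to [k.+1] cells,
    where [high_of_matching] gives a contradiction. When [L] cannot be extended, the lines free of
    [K], [X] and [L] meet only in [z], and swapping one of these [z]-cells into [K], which keeps it
    low by [high_swap], frees a row and a column. *)
Lemma high_always s K0 : 0 < k -> ~ exact -> s != z -> mono z k K0 -> high s K0.
Proof.
move=> k0 nex sz mK0; suff [//|low0] : high s K0 \/ ~ high s K0.
  exfalso; have stage n : n <= k.+1 -> exists K X L, [/\ mono z k K, ~ high s K, mono s k.+1 X,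
      {in X, forall c, (c.1 \notin rows K) && (c.2 \notin cols K)} &
      [/\ matching L, L \subset nonz (~: (rows K :|: rows X)) (~: (cols K :|: cols X)) & #|L| = n]].
    elim: n => [_|n IH nk].
      have [X mX XK] := mono_in_rest s mK0.
      by exists K0, X, set0; split=> //; split; rewrite ?matching0 ?sub0set ?cards0.
    have [K [X [L [mK low mX XK [mL LE Ln]]]]] := IH (ltnW nk).
    have cR := card_rest_rows2 mK mX XK; have cC := card_rest_cols2 mK mX XK.
    move: cR cC LE; set R := ~: (rows K :|: rows X); set C := ~: (cols K :|: cols X) => cR cC LE.
    have LR : rows L \subset R.
      by apply/subsetP => _ /imsetP[c /(subsetP LE) + ->]; rewrite !inE => /andP[/andP[]].
    have LC : cols L \subset C.
      by apply/subsetP => _ /imsetP[c /(subsetP LE) + ->]; rewrite !inE => /andP[/andP[]].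
    have cER : #|R :\: rows L| = k.+2 - n by rewrite cardsD (setIidPr LR) cR card_rows ?Ln.
    have cEC : #|C :\: cols L| = k.+2 - n by rewrite cardsD (setIidPr LC) cC card_cols ?Ln.
    have another (T : finType) (A : {set T}) x : #|A| = k.+2 - n -> exists2 y, y \in A & y != x.
      move=> cA; have : 0 < #|A :\ x|.
        by have := cardsD1 x A; case: (x \in A); rewrite cA; move: nk; clear; lia.
      by rewrite card_gt0 => /set0Pn[y]; rewrite !inE => /andP[yx yA]; exists y.
    have grow K' (L' : cells P Q) p q : mono z k K' -> ~ high s K' ->
        {in X, forall c, (c.1 \notin rows K') && (c.2 \notin cols K')} ->
        matching L' -> L' \subset nonz (~: (rows K' :|: rows X)) (~: (cols K' :|: cols X)) -> #|L'| = n ->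
        p \notin rows K' :|: rows X -> q \notin cols K' :|: cols X ->
        p \notin rows L' -> q \notin cols L' -> f p q != z ->
        exists K X L, [/\ mono z k K, ~ high s K, mono s k.+1 X,
          {in X, forall c, (c.1 \notin rows K) && (c.2 \notin cols K)} &
          [/\ matching L, L \subset nonz (~: (rows K :|: rows X)) (~: (cols K :|: cols X)) & #|L| = n.+1]].
      move=> mK' low' XK' mL' LE' L'n pR qC pL qL fpq; exists K', X, ((p, q) |: L'); split=> //; split.
      - exact: matching_add.
      - by rewrite subUset LE' sub1set inE in_setX !in_setC pR qC fpq.
      - by rewrite cardsU1 L'n (contra (@mem_rows _ _ L' (p, q)) pL).
    have inE2 (T : finType) (D F : {set T}) x : x \in ~: D :\: F -> (x \notin D) * (x \notin F).
      by case/setDP; rewrite inE => -> ->.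
    have [[p q] /= /andP[/andP[/inE2[pR pL] /inE2[qC qL]] fpq]|allE] :=
        pickP (fun c => (c.1 \in R :\: rows L) && (c.2 \in C :\: cols L) && (f c.1 c.2 != z)).
      exact: (grow K L p q).
    have zE i j : i \in R :\: rows L -> j \in C :\: cols L -> f i j = z.
      by move=> iE jE; have := allE (i, j); rewrite /= iE jE => /negbT; rewrite negbK => /eqP.
    (* The cell [c] of [K] is exchanged for the [z]-cell [(i, j)], and [L] grows by a cell [(p, q)]
       that may use the lines of [c]. *)
    have swapped c i j p q : c \in K -> i \in R :\: rows L -> j \in C :\: cols L ->
        p \notin rows ((i, j) |: K :\ c) -> q \notin cols ((i, j) |: K :\ c) ->
        p \notin rows X -> q \notin cols X -> p \notin rows L -> q \notin cols L -> f p q != z ->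
        exists K X L, [/\ mono z k K, ~ high s K, mono s k.+1 X,
          {in X, forall c, (c.1 \notin rows K) && (c.2 \notin cols K)} &
          [/\ matching L, L \subset nonz (~: (rows K :|: rows X)) (~: (cols K :|: cols X)) & #|L| = n.+1]].
      move=> cK iE jE pK qK pX qX pL qL fpq.
      have fij := zE i j iE jE; have [iR iL] := inE2 _ _ _ _ iE; have [jC jL] := inE2 _ _ _ _ jE.
      move: iR jC; rewrite !in_setU !negb_or => /andP[iK iX] /andP[jK jX].
      have low' := high_swap k0 nex sz mK cK iK jK fij low.
      have mtK : matching K by case/and3P: mK.
      have mK' : mono z k ((i, j) |: K :\ c).
        move: (mK); rewrite -{1}(ltn_predK k0) => /mono_del/(_ cK) mD.
        rewrite -(ltn_predK k0); apply: mono_add mD _ _ fij.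
          by rewrite rowsD1 // in_setD1 (negPf iK) andbF.
        by rewrite colsD1 // in_setD1 (negPf jK) andbF.
      apply: (grow ((i, j) |: K :\ c) L p q) => //.
      - move=> d dX; have /andP[dK1 dK2] := XK d dX.
        rewrite rowsU1 colsU1 !in_setU1 !negb_or rowsD1 // colsD1 // !in_setD1.
        rewrite (negPf dK1) (negPf dK2) !andbF !andbT.
        by apply/andP; split; [apply: contraNneq iX => /= <-; apply: mem_rows|
          apply: contraNneq jX => /= <-; apply: mem_cols].
      - apply/subsetP => d dL; have := subsetP LE _ dL.
        rewrite !inE !negb_or => /andP[/andP[/andP[dK1 dX1] /andP[dK2 dX2]] fd].
        rewrite dX1 dX2 fd.
        rewrite rowsU1 colsU1 !in_setU1 !negb_or rowsD1 // colsD1 // !in_setD1.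
        rewrite (negPf dK1) (negPf dK2) !andbF !andbT.
        by apply/andP; split; [apply: contraNneq iL => /= <-; apply: mem_rows|
          apply: contraNneq jL => /= <-; apply: mem_cols].
      - by rewrite in_setU negb_or pK.
      - by rewrite in_setU negb_or qK.
    have mtK : matching K by case/and3P: mK.
    have LnK c : c \in L -> [/\ c.1 \notin rows K, c.2 \notin cols K, c.1 \notin rows X & c.2 \notin cols X].
      move=> /(subsetP LE); rewrite !inE !negb_or.
      by case/andP=> /andP[/andP[-> ->] /andP[-> ->]].
    have LnK1 c : c \in K -> c.1 \notin rows L.
      move=> cK; apply/imsetP => -[d dL E]; have [+ _ _ _] := LnK d dL.
      by rewrite -E mem_rows.
    have LnK2 c : c \in K -> c.2 \notin cols L.
      move=> cK; apply/imsetP => -[d dL E]; have [_ + _ _] := LnK d dL.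
      by rewrite -E mem_cols.
    have XnK1 c : c \in K -> c.1 \notin rows X.
      move=> cK; apply/imsetP => -[d dX E]; have /andP[+ _] := XK d dX.
      by rewrite -E mem_rows.
    have XnK2 c : c \in K -> c.2 \notin cols X.
      move=> cK; apply/imsetP => -[d dX E]; have /andP[_] := XK d dX.
      by rewrite -E mem_cols.
    have [i2 i2E _] : exists2 i2, i2 \in R :\: rows L & true.
      have : 0 < #|R :\: rows L| by rewrite cER; move: nk; clear; lia.
      by rewrite card_gt0 => /set0Pn[i2]; exists i2.
    have [j2 j2E _] : exists2 j2, j2 \in C :\: cols L & true.
      have : 0 < #|C :\: cols L| by rewrite cEC; move: nk; clear; lia.
      by rewrite card_gt0 => /set0Pn[j2]; exists j2.
    have [i2R i2L] := inE2 _ _ _ _ i2E; have [j2C j2L] := inE2 _ _ _ _ j2E.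
    move: (i2R) (j2C); rewrite !in_setU !negb_or => /andP[i2K i2X] /andP[j2K j2X].
    (* As [n <= k], at least two free columns remain, so the [z]-cell swapped into [K] can be chosen
       off column [j2], which stays available for [(c.1, j2)]. *)
    have [c /andP[cK fc]|colK] := pickP (fun c => (c \in K) && (f c.1 j2 != z)).
      have [i iE _] := another _ _ i2 cER; have [j jE jj2] := another _ _ j2 cEC.
      have [iR _] := inE2 _ _ _ _ iE; rewrite in_setU negb_or in iR; have /andP[iK _] := iR.
      apply: (swapped c i j c.1 j2) => //; rewrite ?LnK1 ?XnK1 //.
        rewrite rowsU1 rowsD1 // !inE eqxx /= orbF.
        by apply: contraNneq iK => <-; apply: mem_rows.
      by rewrite colsU1 colsD1 // !inE /= (negPf j2K) andbF orbF eq_sym.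
    have [c /andP[cK fc]|rowK] := pickP (fun c => (c \in K) && (f i2 c.2 != z)).
      have [i iE ii2] := another _ _ i2 cER; have [j jE _] := another _ _ j2 cEC.
      have [jC _] := inE2 _ _ _ _ jE; rewrite in_setU negb_or in jC; have /andP[jK _] := jC.
      apply: (swapped c i j i2 c.2) => //; rewrite ?LnK2 ?XnK2 //.
        by rewrite rowsU1 rowsD1 // !inE /= (negPf i2K) andbF orbF eq_sym.
      rewrite colsU1 colsD1 // !inE eqxx /= orbF.
      by apply: contraNneq jK => <-; apply: mem_cols.
    have zcol p : p \in rows K :|: (R :\: rows L) -> f p j2 = z.
      case/setUP=> [/imsetP[c cK ->]|pE]; last exact: zE.
      by have := colK c; rewrite cK /= => /negbT; rewrite negbK => /eqP.
    have zrow q : q \in cols K :|: (C :\: cols L) -> f i2 q = z.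
      case/setUP=> [/imsetP[c cK ->]|qE]; last exact: zE.
      by have := rowK c; rewrite cK /= => /negbT; rewrite negbK => /eqP.
    have cK : #|K| = k by case/and3P: mK => _ _ /eqP.
    have cU1 : #|rows K :|: (R :\: rows L)| = k + (k.+2 - n).
      have : [disjoint rows K & R :\: rows L].
        rewrite disjoint_sym disjoint_subset; apply/subsetP => p /inE2[+ _].
        by rewrite in_setU negb_or => /andP[].
      by rewrite -leq_card_setU => /eqP->; rewrite card_rows // cK cER.
    have cU2 : #|cols K :|: (C :\: cols L)| = k + (k.+2 - n).
      have : [disjoint cols K & C :\: cols L].
        rewrite disjoint_sym disjoint_subset; apply/subsetP => p /inE2[+ _].
        by rewrite in_setU negb_or => /andP[].
      by rewrite -leq_card_setU => /eqP->; rewrite card_cols // cK cEC.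
    have sub1 : rows K :|: (R :\: rows L) \subset [set p | f p j2 == z].
      by apply/subsetP => p /zcol fp; rewrite inE fp.
    have sub2 : cols K :|: (C :\: cols L) \subset [set q | f i2 q == z].
      by apply/subsetP => q /zrow fq; rewrite inE fq.
    have ge1 := subset_leq_card sub1; have ge2 := subset_leq_card sub2.
    have d1 := degQ j2 z; have d2 := degP i2 z; rewrite cU1 in ge1; rewrite cU2 in ge2.
    (* Column [j2] and row [i2] are [z] on the [k] lines of [K] and on [k.+2 - n] free lines. The
       bound [k.+2] forces [n = k] and leaves no other [z] in them. *)
    have E1 : rows K :|: (R :\: rows L) = [set p | f p j2 == z].
      by apply/eqP; rewrite eqEcard sub1 cU1; move: ge1 d1 nk; clear; lia.
    have E2 : cols K :|: (C :\: cols L) = [set q | f i2 q == z].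
      by apply/eqP; rewrite eqEcard sub2 cU2; move: ge2 d2 nk; clear; lia.
    have : 0 < #|L| by rewrite Ln; move: ge1 d1 nk k0; clear; lia.
    rewrite card_gt0 => /set0Pn[[p q] pqL]; have [pK qK pX qX] := LnK _ pqL; simpl in pK, qK, pX, qX.
    have fp : f p j2 != z.
      have : p \notin [set p | f p j2 == z].
        by rewrite -E1 !inE (negPf pK) (mem_rows pqL).
      by rewrite inE.
    have fq : f i2 q != z.
      have : q \notin [set q | f i2 q == z].
        by rewrite -E2 !inE (negPf qK) (mem_cols pqL).
      by rewrite inE.
    have pr := mem_rows pqL; have qc := mem_cols pqL; simpl in pr, qc.
    have pi2 : p != i2 by apply: contraNneq i2L => <-.
    have qj2 : j2 != q by apply: contraNneq j2L => ->.
    (* A cell [(p, q)] of [L], which is nonempty because [n = k] and [0 < k], gives way to two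
       cells, which are not [z] because [p] and [q] are outside the lines just counted. *)
    exists K, X, ((p, j2) |: ((i2, q) |: L :\ (p, q))); split=> //; split.
    - apply: matching_add; last first.
      + by rewrite colsU1 colsD1 // !inE /= (negPf qj2) (negPf j2L).
      + by rewrite rowsU1 rowsD1 // !inE /= eqxx (negPf pi2).
      + apply: matching_add; first exact: matchingS (subsetDl _ _) mL.
        * by rewrite rowsD1 // !inE (negPf i2L) andbF.
        * by rewrite colsD1 // !inE /= eqxx.
    - rewrite !subUset !sub1set (subset_trans (subsetDl _ _) LE) andbT.
      rewrite !(inE, in_setX) /= fp fq (negPf pK) (negPf qK) (negPf pX) (negPf qX).
      by rewrite (negPf i2K) (negPf i2X) (negPf j2K) (negPf j2X).
    - have n1 : (p, j2) \notin L by apply: contra j2L => H; apply: (mem_cols H).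
      have n2 : (i2, q) \notin L by apply: contra i2L => H; apply: (mem_rows H).
      have n3 : (p, j2) \notin (i2, q) |: L :\ (p, q).
        by rewrite !inE (negPf n1) andbF orbF xpair_eqE (negPf pi2).
      have n4 : (i2, q) \notin L :\ (p, q) by rewrite !inE (negPf n2) andbF.
      by rewrite cardsU1 n3 cardsU1 n4 -Ln (cardsD1 (p, q) L) pqL.
  have [K [X [L [mK low mX XK [mL LE Ln]]]]] := stage k.+1 (leqnn _).
  by apply: low; apply: (high_of_matching sz mX XK mL LE); rewrite Ln.
have [/existsP[N /andP[nN lN]]|H] := boolP [exists N, nearK K0 N && (k.+1 <= cnt s N)].
  by left; exists N.
by right=> -[N nN lN]; case/existsP: H; exists N; rewrite nN.
Qed.

Lemma exact_dec : exact \/ ~ exact.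
Proof.
have [/existsP[K /existsP[N /and3P[mK nN /forallP H]]]|H] := boolP [exists K, [exists N,
    [&& mono z k K, nearK K N & [forall s, (s != z) ==> (cnt s N == k.+1)]]]].
  by left; exists K, N; split=> // s sz; apply/eqP; have := H s; rewrite sz.
right=> -[K [N [mK nN cN]]]; case/existsP: H; exists K; apply/existsP; exists N.
by rewrite mK nN; apply/forallP => s; apply/implyP => /cN ->.
Qed.

Lemma exact_exists : 0 < k -> exact.
Proof.
move=> k0; have [//|nex] := exact_dec; exfalso; apply: (nex).
have [|K mK _] := @mono_exists z k set0 set0; first by rewrite !cards0; clear; lia.
have [s [s' [sz s'z ss']]] := other_colors.
by apply: (exact_of_high mK sz s'z ss'); apply: high_always.
Qed.

Lemma rest_matching : exact ->
  exists2 N : cells P Q, matching N & forall s, cnt s N + (s == z) = k.+1.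
Proof.
case=> K [N [/and3P[mK Kz /eqP Kk] /and3P[mN /subsetP NE _] cN]].
have KN : {in K & N, forall c d, ~~ conflict c d}.
  move=> c d cK /NE; rewrite !inE => /andP[/andP[d1 d2] _]; rewrite /conflict negb_or.
  by apply/andP; split; [apply: contraNneq d1 => <-; apply: mem_rows|
    apply: contraNneq d2 => <-; apply: mem_cols].
exists (K :|: N) => [|s]; first exact: matchingU.
have [->|sz] := eqVneq s z.
  rewrite addn1 -Kk; congr _.+1; apply: eq_card => c; rewrite !inE.
  have [cK|cK] /= := boolP (c \in K); first by have := subsetP Kz c cK; rewrite inE.
  by apply: contraTF isT => /andP[/NE]; rewrite !inE => /andP[_ /negPf->].
rewrite addn0 -(cN s sz); apply: eq_card => c; rewrite !inE.
have [cK|cK] //= := boolP (c \in K).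
have := subsetP Kz c cK; rewrite inE => /eqP->; rewrite eq_sym (negPf sz).
by rewrite andbF.
Qed.

(** In order 3, an [s]-cell and a non-[z] cell off its lines complete the empty [K] with enough
    [s]-cells. Hence, for a colour [s] that is not high, all cells off the lines of any [s]-cell are
    [z]. One more [z] on these lines would fill a line with three [z], and a second [s] on them
    would force a [z] onto the other line. *)
Lemma rest_cross : k = 0 -> ~ exact -> exists s r c, [/\ s != z, f r c = s,
  (forall p q, p != r -> q != c -> f p q = z),
  (forall p, p != r -> f p c != s /\ f p c != z) &
  (forall q, q != c -> f r q != s /\ f r q != z)].
Proof.
move=> k0 nex; have mK : mono z k set0 by rewrite /mono matching0 sub0set cards0 k0.
have rows0 : rows (set0 : cells P Q) = set0 by apply: imset0.
have cols0 : cols (set0 : cells P Q) = set0 by apply: imset0.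
have [s sz low] : exists2 s, s != z & ~ high s set0.
  have [s [s' [sz s'z ss']]] := other_colors.
  have [H|/existsP H] := boolP [exists N, nearK set0 N && (k.+1 <= cnt s N)]; last first.
    by exists s => // -[N nN lN]; apply: H; exists N; rewrite nN.
  exists s' => // hs'; apply: nex; apply: (exact_of_high mK sz s'z ss' _ hs').
  by case/existsP: H => N /andP[nN lN]; exists N.
have minor r c : f r c = s -> forall p q, p != r -> q != c -> f p q = z.
  move=> frc p q pr qc; apply/eqP/negPn/negP => nz; apply: low.
  apply: (@high_of_matching s set0 [set (r, c)] [set (p, q)]) => //.
  - by rewrite /mono matching1 sub1set inE /= frc eqxx cards1 k0.
  - by move=> d _; rewrite rows0 cols0 !inE.
  - exact: matching1.
  - rewrite sub1set rows0 cols0 !set0U /rows /cols !imset_set1 !inE /=.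
    by rewrite pr qc nz.
  - by rewrite cards1 k0.
have [[r c] frc] : exists d, f d.1 d.2 = s.
  have : 0 < #|[set c : P * Q | f c.1 c.2 == s]| by apply: leq_ltn_trans (total s).
  by rewrite card_gt0 => /set0Pn[d]; rewrite inE => /eqP; exists d.
rewrite /= in frc.
have nzc p : p != r -> f p c != z.
  move=> pr; apply/negP => /eqP fz; have := degP p z; rewrite k0 leqNgt => /negP; apply.
  have -> : [set q | f p q == z] = setT; last by rewrite cardsT cQ k0.
  apply/setP => q; rewrite !inE; have [->|qc] := eqVneq q c; first by rewrite fz eqxx.
  by rewrite (minor r c frc) ?eqxx.
have nzr q : q != c -> f r q != z.
  move=> qc; apply/negP => /eqP fz; have := degQ q z; rewrite k0 leqNgt => /negP; apply.
  have -> : [set p | f p q == z] = setT; last by rewrite cardsT cP k0.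
  apply/setP => p; rewrite !inE; have [->|pr] := eqVneq p r; first by rewrite fz eqxx.
  by rewrite (minor r c frc) ?eqxx.
have /set0Pn[p0] : [set~ r] != set0 by rewrite -card_gt0 cardsC1 cP k0.
have /set0Pn[q0] : [set~ c] != set0 by rewrite -card_gt0 cardsC1 cQ k0.
rewrite !inE => q0c p0r; exists s, r, c; split=> //; first exact: minor.
  move=> p pr; split; last exact: nzc.
  apply: contraNneq (nzr q0 q0c) => fs; apply/eqP.
  by apply: (minor p c fs) => //; rewrite eq_sym.
move=> q qc; split; last exact: nzr.
apply: contraNneq (nzc p0 p0r) => fs; apply/eqP.
by apply: (minor r q fs) => //; rewrite eq_sym.
Qed.

End Rest.

(** * Completing a partial diagonal by a gadget *)

Definition frequency (P Q : finType) (f : P -> Q -> 'I_3) l :=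
  (forall p s, #|[set q | f p q == s]| = l) /\ (forall q s, #|[set p | f p q == s]| = l).

Definition has_balanced (P Q : finType) (f : P -> Q -> 'I_3) l :=
  exists2 D : cells P Q, matching D & forall s, cnt f s D = l.

(* The colour counts of the three diagonals of the [I x J] subarray are obtained from
   the multiset [z, x, y, z] by deleting each of the three colours in turn. *)
Definition gadget (P Q : finType) (f : P -> Q -> 'I_3) (z : 'I_3) (I : {set P}) (J : {set Q}) :=
  [/\ #|I| = 3, #|J| = 3 & forall e : 'I_3, exists G : cells P Q,
    [/\ matching G, G \subset setX I J & forall s, cnt f s G + (s == e) = 1 + (s == z)]].

Section Counts.

Variables (P Q : finType) (f : P -> Q -> 'I_3).
Implicit Types (M N : cells P Q).

Lemma cnt_sum M : \sum_(s : 'I_3) cnt f s M = #|M|.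
Proof.
rewrite -sum1_card (partition_big (fun c => f c.1 c.2) xpredT) //=.
by apply: eq_bigr => s _; rewrite /cnt -sum1_card; apply: eq_bigl => c; rewrite inE.
Qed.

Lemma cntU s M N : [disjoint M & N] -> cnt f s (M :|: N) = cnt f s M + cnt f s N.
Proof.
move=> d; pose A (L : cells P Q) : cells P Q := [set c in L | f c.1 c.2 == s].
have sub L : A L \subset L by apply/subsetP => c; rewrite inE => /andP[].
have dA : A M :&: A N = set0 by apply/disjoint_setI0/(disjointWl (sub M))/(disjointWr (sub N)).
rewrite -[RHS]subn0 -(cards0 (P * Q)%type) -dA -cardsU; apply: eq_card => c; rewrite !inE.
by rewrite andb_orl.
Qed.

Lemma cnt1 s c : cnt f s [set c] = (f c.1 c.2 == s).
Proof.
case: eqP => [E|E].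
  suff -> : cnt f s [set c] = #|[set c]| by rewrite cards1.
  by apply: eq_card => d; rewrite !inE; case: eqP => // ->; rewrite E eqxx.
apply: eq_card0 => d; rewrite !inE; case: eqP => // ->; exact/eqP.
Qed.

Lemma disjoint_rows M N : [disjoint rows M & rows N] -> [disjoint M & N].
Proof.
move=> d; rewrite disjoint_subset; apply/subsetP => c cM; rewrite inE.
by apply/negP => cN; have := disjointFr d (mem_rows cM); rewrite mem_rows.
Qed.

Lemma matchingU_lines M N : matching M -> matching N ->
  [disjoint rows M & rows N] -> [disjoint cols M & cols N] -> matching (M :|: N).
Proof.
move=> mM mN dR dC; apply: matchingU => // c d cM dN; rewrite /conflict negb_or.
apply/andP; split; apply/eqP => E.
  by have := disjointFr dR (mem_rows cM); rewrite E mem_rows.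
by have := disjointFr dC (mem_cols cM); rewrite E mem_cols.
Qed.

Lemma card_color_total l s : frequency f l -> #|P| * l = #|[set c : P * Q | f c.1 c.2 == s]|.
Proof.
case=> fP _; rewrite -cardsT -sum_nat_const -[LHS](eq_bigr _ (fun p _ => fP p s)).
by rewrite -card_rel; apply: eq_card => c; rewrite !inE.
Qed.

End Counts.

Section Restriction.

Variables (P Q : finType) (f : P -> Q -> 'I_3) (l : nat) (I : {set P}) (J : {set Q}).
Hypothesis freq : frequency f l.

Let P' := {p : P | p \notin I}.
Let Q' := {q : Q | q \notin J}.

Definition rest (p : P') (q : Q') := f (val p) (val q).

Definition lift_cells (M : cells P' Q') : cells P Q := [set (val c.1, val c.2) | c in M].

Lemma card_sub (T : finType) (A : {set T}) : #|{: {x | x \notin A}}| = #|T| - #|A|.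
Proof.
by rewrite card_sig -[in RHS](setCK A) -cardsCs; apply: eq_card => x; rewrite !inE.
Qed.

Lemma lift_inj : injective (fun c : P' * Q' => (val c.1, val c.2)).
Proof. by move=> [p q] [p' q'] [/val_inj-> /val_inj->]. Qed.

Lemma rows_lift M : rows (lift_cells M) = val @: rows M.
Proof. by rewrite /rows /lift_cells -!imset_comp. Qed.

Lemma cols_lift M : cols (lift_cells M) = val @: cols M.
Proof. by rewrite /cols /lift_cells -!imset_comp. Qed.

Lemma matching_lift M : matching M -> matching (lift_cells M).
Proof.
move=> /matchingP mM; apply/matchingP => _ _ /imsetP[c cM ->] /imsetP[d dM ->].
by rewrite /conflict /= !(inj_eq val_inj) => cd; rewrite (mM c d).
Qed.

Lemma cnt_lift s M : cnt f s (lift_cells M) = cnt rest s M.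
Proof.
rewrite /cnt -(card_imset _ lift_inj); apply: eq_card => c; rewrite !inE.
apply/andP/imsetP => [[/imsetP[d dM ->] fd]|[d]].
  by exists d; rewrite // inE dM.
by rewrite inE => /andP[dM fd] ->; split=> //; apply: imset_f.
Qed.

Lemma lift_avoid M : (rows (lift_cells M) \subset ~: I) * (cols (lift_cells M) \subset ~: J).
Proof.
by rewrite rows_lift cols_lift; split; apply/subsetP => _ /imsetP[x _ ->];
   rewrite inE; apply: (valP x).
Qed.

Lemma rest_rows p s : #|[set q | rest p q == s]| <= l.
Proof.
rewrite -(freq.1 (val p) s) -(card_imset _ val_inj); apply: subset_leq_card.
by apply/subsetP => _ /imsetP[q + ->]; rewrite !inE.
Qed.

Lemma rest_cols q s : #|[set p | rest p q == s]| <= l.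
Proof.
rewrite -(freq.2 (val q) s) -(card_imset _ val_inj); apply: subset_leq_card.
by apply/subsetP => _ /imsetP[p + ->]; rewrite !inE.
Qed.

(** Inclusion-exclusion over the removed lines: the cells of the block lie on two of them. *)
Lemma rest_total s :
  #|P| * l + #|[set c in setX I J | f c.1 c.2 == s]| =
  #|[set c : P' * Q' | rest c.1 c.2 == s]| + (#|I| + #|J|) * l.
Proof.
have cI : #|[set c : P * Q | (c.1 \in I) && (f c.1 c.2 == s)]| = #|I| * l.
  by rewrite (card_rel (fun p q => f p q == s)) -sum_nat_const; apply: eq_bigr => p _; apply: freq.1.
have cJ : #|[set c : P * Q | (c.2 \in J) && (f c.1 c.2 == s)]| = #|J| * l.
  rewrite (card_rel_swap (fun p q => (q \in J) && (f p q == s))).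
  rewrite (card_rel (fun q p => f p q == s)) -sum_nat_const.
  by apply: eq_bigr => q _; apply: freq.2.
rewrite (card_color_total s freq) mulnDl -cI -cJ.
set T := [set c : P * Q | f c.1 c.2 == s].
set SI := [set c : P * Q | (c.1 \in I) && _]; set SJ := [set c : P * Q | (c.2 \in J) && _].
have -> : #|[set c : P' * Q' | rest c.1 c.2 == s]| = #|T :\: (SI :|: SJ)|.
  rewrite -(card_imset _ lift_inj); apply: eq_card => -[p q]; apply/imsetP/idP.
    case=> d; rewrite !inE /= => fd [-> ->]; rewrite fd !andbT negb_or.
    by rewrite (valP d.1) (valP d.2).
  rewrite !inE /= => /andP[+ fpq]; rewrite fpq !andbT negb_or => /andP[pI qJ].
  by exists (exist _ p pI, exist _ q qJ); rewrite ?inE.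
have sU : SI :|: SJ \subset T.
  by apply/subsetP => c; rewrite !inE => /orP[] /andP[].
have -> : [set c in setX I J | f c.1 c.2 == s] = SI :&: SJ.
  by apply/setP => c; rewrite !inE; case: (_ == s); rewrite ?andbT ?andbF.
have := cardsID (SI :|: SJ) T; rewrite (setIidPr sU).
by have := cardsUI SI SJ; clear; lia.
Qed.

End Restriction.

(** Deleting a colour other than [s] from the multiset of the gadget keeps [s]. *)
Lemma gadget_color (P Q : finType) (f : P -> Q -> 'I_3) z (I : {set P}) (J : {set Q}) s :
  gadget f z I J -> 0 < #|[set c in setX I J | f c.1 c.2 == s]|.
Proof.
case=> _ _ H; have [s1 [s2 [s1s _ _]]] := other_colors s.
have [G [_ GIJ cG]] := H s1; have := cG s; rewrite eq_sym (negPf s1s) addn0 => E.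
apply: (@leq_trans (cnt f s G)); first by rewrite E.
apply: subset_leq_card; apply/subsetP => c; rewrite [in X in X -> _]inE => /andP[cG' fc].
by rewrite inE fc andbT (subsetP GIJ).
Qed.

Section Gadget.

Variables (P Q : finType) (f : P -> Q -> 'I_3) (k : nat) (z : 'I_3) (I : {set P}) (J : {set Q}).
Hypotheses (cP : #|P| = 3 * k.+2) (cQ : #|Q| = 3 * k.+2).
Hypothesis freq : frequency f k.+2.
Hypothesis gadIJ : gadget f z I J.

Local Notation g := (@rest P Q f I J).

Lemma card_restP : #|{: {p : P | p \notin I}}| = 3 * k + 3.
Proof. by case: gadIJ => cI _ _; rewrite card_sub cP cI; clear; lia. Qed.

Lemma card_restQ : #|{: {q : Q | q \notin J}}| = 3 * k + 3.
Proof. by case: gadIJ => _ cJ _; rewrite card_sub cQ cJ; clear; lia. Qed.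

Lemma rest_color_total s : 3 * k * k + 6 * k < #|[set c | g c.1 c.2 == s]|.
Proof.
have := gadget_color s gadIJ; have := rest_total I J freq s.
case: gadIJ => -> -> _; rewrite cP.
by move: #|[set c in setX I J | _]| => u; move: #|[set c | _]| => v; clear; lia.
Qed.

(* Any colour of the last remaining cell is compensated by a diagonal of the gadget. *)
Lemma balanced_of_exact : exact g k z -> has_balanced f k.+2.
Proof.
move=> /rest_matching[N mN cN]; have [cI cJ diag] := gadIJ.
have Nk : #|N| < 3 * k + 3.
  have : \sum_(s : 'I_3) (cnt g s N + (s == z)) = \sum_(s : 'I_3) k.+1 by apply: eq_bigr.
  rewrite big_split /= cnt_sum sum_nat_const card_ord (bigD1 z) //= eqxx.
  by clear; lia.
have /set0Pn[r] : ~: rows N != set0.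
  by rewrite -card_gt0 cardsCs setCK card_rows // card_restP subn_gt0.
have /set0Pn[c] : ~: cols N != set0.
  by rewrite -card_gt0 cardsCs setCK card_cols // card_restQ subn_gt0.
rewrite !inE => cN0 rN0; pose M := (r, c) |: N.
have [G [mG GIJ cG]] := diag (g r c).
have mM : matching M by apply: matching_add.
have rG : rows G \subset I.
  by apply/subsetP => _ /imsetP[d /(subsetP GIJ) + ->]; rewrite inE => /andP[].
have cGJ : cols G \subset J.
  by apply/subsetP => _ /imsetP[d /(subsetP GIJ) + ->]; rewrite inE => /andP[].
have dR : [disjoint rows (lift_cells M) & rows G].
  rewrite disjoint_subset; apply/subsetP => x /(subsetP (lift_avoid M).1).
  by rewrite !inE; apply: contra; apply/subsetP.
have dC : [disjoint cols (lift_cells M) & cols G].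
  rewrite disjoint_subset; apply/subsetP => x /(subsetP (lift_avoid M).2).
  by rewrite !inE; apply: contra; apply/subsetP.
exists (lift_cells M :|: G); first by apply: matchingU_lines; rewrite ?matching_lift.
move=> s; rewrite cntU ?disjoint_rows // cnt_lift.
have -> : cnt g s M = (g r c == s) + cnt g s N.
  rewrite /M cntU ?cnt1 //= disjoints1; apply: contra rN0; exact: mem_rows.
have := cG s; have := cN s; rewrite [s == g r c]eq_sym.
by case: (s == z); case: (_ == s) => /=; clear; lia.
Qed.

End Gadget.

Lemma I3_cover (x y z s : 'I_3) : y != z -> x != y -> x != z ->
  (x == s) + (y == s) + (z == s) = 1.
Proof.
rewrite -!val_eqE /=.
by case: x y z s => [[|[|[|x]]] ?] [[|[|[|y]]] ?] [[|[|[|z]]] ?] [[|[|[|s]]] ?].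
Qed.

Lemma uniq_map_inj (T : eqType) (S : eqType) (h : T -> S) (s : seq T) :
  uniq (map h s) -> {in s &, injective h}.
Proof.
elim: s => //= a s IH /andP[ha us] b d; rewrite !inE => /predU1P[->|bs] /predU1P[->|ds] //.
- by move=> E; rewrite E map_f in ha.
- by move=> E; rewrite -E map_f in ha.
exact: IH.
Qed.

Lemma matching_seq (P Q : finType) (cs : seq (P * Q)) :
  uniq [seq c.1 | c <- cs] -> uniq [seq c.2 | c <- cs] -> matching [set c in cs].
Proof.
move=> u1 u2; apply/matchingP => c d; rewrite !inE => cM dM /orP[] /eqP E.
  exact: (uniq_map_inj u1).
exact: (uniq_map_inj u2).
Qed.

Lemma cnt_seq (P Q : finType) (f : P -> Q -> 'I_3) s (cs : seq (P * Q)) :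
  uniq [seq c.1 | c <- cs] -> cnt f s [set c in cs] = count_mem s [seq f c.1 c.2 | c <- cs].
Proof.
move=> u1; rewrite count_map -size_filter -(card_uniqP (filter_uniq _ (map_uniq u1))).
by apply: eq_card => c; rewrite !inE mem_filter andbC.
Qed.

Lemma balanced_of_seq (P Q : finType) (f : P -> Q -> 'I_3) l (cs : seq (P * Q)) :
  uniq [seq c.1 | c <- cs] -> uniq [seq c.2 | c <- cs] ->
  (forall s, count_mem s [seq f c.1 c.2 | c <- cs] = l) -> has_balanced f l.
Proof.
move=> u1 u2 cnts; exists [set c in cs]; first exact: matching_seq.
by move=> s; rewrite cnt_seq.
Qed.

(** * Gadgets for lambda = 2 *)

Section Cross.

Variables (P Q : finType) (f : P -> Q -> 'I_3) (x y z : 'I_3) (I : {set P}) (J : {set Q}).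
Hypotheses (yz : y != z) (xy : x != y) (xz : x != z).
Hypotheses (cP : #|P| = 6) (freq : frequency f 2) (cI : #|I| = 3).
Variables (r p1 p2 : P) (c q1 q2 : Q).
Hypotheses (uP : uniq [:: r; p1; p2]) (uQ : uniq [:: c; q1; q2]).
Hypotheses (nP : {in [:: r; p1; p2], forall p, p \notin I}).
Hypotheses (nQ : {in [:: c; q1; q2], forall q, q \notin J}).
Hypotheses (frc : f r c = y) (frq1 : f r q1 = x).
Hypotheses (f11 : f p1 q1 = z) (f12 : f p1 q2 = z) (f21 : f p2 q1 = z) (f22 : f p2 q2 = z).

(** The diagonal has two cells in the gadget and two in the rest; [(i1, qa)] and [(pa, j1)] lie in
    the two mixed blocks. *)
Lemma balanced_of_cells i1 i2 i3 j1 j2 j3 pa pb qa qb :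
  uniq [:: i1; i2; i3] -> {in [:: i1; i2; i3], forall i, i \in I} ->
  uniq [:: j1; j2; j3] -> {in [:: j1; j2; j3], forall j, j \in J} ->
  perm_eq [:: r; pa; pb] [:: r; p1; p2] -> perm_eq [:: c; qa; qb] [:: c; q1; q2] ->
  (forall s, count_mem s [:: f i1 qa; f i2 j2; f i3 j3; f pa j1; f r c; f pb qb] = 2) ->
  has_balanced f 2.
Proof.
move=> ui iI uj jJ pP pQ cnts.
apply: (@balanced_of_seq _ _ f 2 [:: (i1, qa); (i2, j2); (i3, j3); (pa, j1); (r, c); (pb, qb)]) => //.
  have -> : uniq [seq d.1 | d <- [:: (i1, qa); (i2, j2); (i3, j3); (pa, j1); (r, c); (pb, qb)]]
     = uniq ([:: i1; i2; i3] ++ [:: r; pa; pb]).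
    by apply: perm_uniq; rewrite /= !perm_cons -[X in perm_eq X _](cat1s pa) -(cat1s r) perm_catCA.
  rewrite cat_uniq ui (perm_uniq pP) uP andbT andTb; apply/hasPn => p; rewrite (perm_mem pP) => pr.
  by apply: contra (nP pr); apply: iI.
have -> : uniq [seq d.2 | d <- [:: (i1, qa); (i2, j2); (i3, j3); (pa, j1); (r, c); (pb, qb)]]
   = uniq ([:: j1; j2; j3] ++ [:: c; qa; qb]).
  by apply: perm_uniq; apply/permP => a /=; clear; lia.
rewrite cat_uniq uj (perm_uniq pQ) uQ andbT andTb; apply/hasPn => q; rewrite (perm_mem pQ) => qr.
by apply: contra (nQ qr); apply: jJ.
Qed.

Lemma rest_row p : p \notin I -> p \in [:: r; p1; p2].
Proof.
move=> pI; have /eqP E : [set r; p1; p2] == ~: I.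
  rewrite eqEcard cardsCs setCK cP cI; apply/andP; split.
    by apply/subsetP => p'; rewrite !inE => H; apply: nP; rewrite !inE orbA.
  rewrite (_ : [set r; p1; p2] = [set p in [:: r; p1; p2]]); last first.
    by apply/setP => p'; rewrite !inE orbA.
  by rewrite cardsE (card_uniqP uP).
have : p \in ~: I by rewrite inE.
by rewrite -E !inE orbA.
Qed.

(** Column [q1] has a second [x] besides [(r, q1)], and its other cells off [I] are [z]. *)
Lemma cross_row : exists2 i, i \in I & f i q1 = x.
Proof.
have : 0 < #|[set p | f p q1 == x] :\ r|.
  by have := freq.2 q1 x; rewrite (cardsD1 r) inE frq1 eqxx add1n => -[->].
rewrite card_gt0 => /set0Pn[i]; rewrite !inE => /andP[ir /eqP fi]; exists i => //.
apply/negPn/negP => /rest_row; rewrite !inE (negPf ir) /= => /orP[] /eqP E.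
  by move: xz; rewrite -fi E f11 eqxx.
by move: xz; rewrite -fi E f21 eqxx.
Qed.

(** Of the two cells [y] of column [j] none is in a row of [I] and at most one is in row [r]. *)
Lemma cross_col j : {in I, forall i, f i j != y} -> f p1 j = y \/ f p2 j = y.
Proof.
move=> Hj; have : 0 < #|[set p | f p j == y] :\ r|.
  by have := freq.2 j y; rewrite (cardsD1 r) => E; rewrite lt0n; apply: contra_eqN E => /eqP->; case: (r \in _).
rewrite card_gt0 => /set0Pn[i]; rewrite !inE => /andP[ir /eqP fi].
have /rest_row : i \notin I by apply/negP => /Hj; rewrite fi eqxx.
by rewrite !inE (negPf ir) /= => /orP[] /eqP <-; [left|right].
Qed.

(* With [(i1, q1)], a [y] of column [j1] outside the gadget, [(r, c)] and a [z] of the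
   rest, such a diagonal of the minor would complete a balanced one. *)
Lemma minor_free : ~ has_balanced f 2 -> exists2 i1, i1 \in I &
  forall j1 j2 j3 i2 i3, uniq [:: i1; i2; i3] -> {in [:: i1; i2; i3], forall i, i \in I} ->
  uniq [:: j1; j2; j3] -> {in [:: j1; j2; j3], forall j, j \in J} ->
  {in I, forall i, f i j1 != y} -> ~ (f i2 j2 = x /\ f i3 j3 = z).
Proof.
move=> nb; have [i1 i1I fi1] := cross_row; exists i1 => // j1 j2 j3 i2 i3 ui iI uj jJ Hj [fx fz].
have cnts s : count_mem s [:: x; x; z; y; y; z] = 2.
  by have := @I3_cover x y z s yz xy xz; rewrite /=; clear; lia.
apply: nb; case: (cross_col Hj) => fy.
  apply: (@balanced_of_cells i1 i2 i3 j1 j2 j3 p1 p2 q1 q2) => // s.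
  by rewrite fi1 fx fz fy frc f22 cnts.
apply: (@balanced_of_cells i1 i2 i3 j1 j2 j3 p2 p1 q1 q2) => //.
  by rewrite perm_cons -(cat1s p2) perm_catC.
by move=> s; rewrite fi1 fx fz fy frc f12 cnts.
Qed.

End Cross.

Section Transpose.

Variables P Q : finType.

Definition tr_cells (M : cells P Q) : cells Q P := [set (c.2, c.1) | c in M].

Lemma tr_inj : injective (fun c : P * Q => (c.2, c.1)).
Proof. by move=> [a b] [c d] [-> ->]. Qed.

Lemma matching_tr M : matching M -> matching (tr_cells M).
Proof.
move=> /matchingP mM; apply/matchingP => _ _ /imsetP[c cM ->] /imsetP[d dM ->].
by rewrite /conflict /= orbC => cd; rewrite (mM c d).
Qed.

Lemma cnt_tr (f : P -> Q -> 'I_3) s M : cnt (fun q p => f p q) s (tr_cells M) = cnt f s M.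
Proof.
rewrite /cnt -[in RHS](card_imset _ tr_inj); apply: eq_card => c; rewrite !inE.
apply/andP/imsetP => [[/imsetP[d dM ->] fd]|[d]].
  by exists d; rewrite // inE dM.
by rewrite inE => /andP[dM fd] ->; split=> //; apply: imset_f.
Qed.

End Transpose.

Lemma balanced_tr (P Q : finType) (f : P -> Q -> 'I_3) l :
  has_balanced (fun q p => f p q) l -> has_balanced f l.
Proof.
case=> D mD cD; exists (tr_cells D); first exact: matching_tr.
by move=> s; rewrite (cnt_tr (fun q p => f p q)).
Qed.

Lemma balanced_dec (P Q : finType) (f : P -> Q -> 'I_3) l :
  has_balanced f l \/ ~ has_balanced f l.
Proof.
have [/existsP[D /andP[mD /forallP cD]]|H] :=
  boolP [exists D : cells P Q, matching D && [forall s, cnt f s D == l]].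
  by left; exists D => // s; apply/eqP.
right=> -[D mD cD]; case/existsP: H; exists D; rewrite mD.
by apply/forallP => s; rewrite cD.
Qed.

Lemma card_nonconflict (P Q : finType) (I : {set P}) (J : {set Q}) (G : cells P Q) :
  matching G -> G \subset setX I J -> #|G| = #|I| -> #|G| = #|J| -> rows G = I /\ cols G = J.
Proof.
move=> mG /subsetP GIJ GI GJ; split; apply/eqP; rewrite eqEcard.
  rewrite card_rows // GI leqnn andbT; apply/subsetP => _ /imsetP[c /GIJ + ->].
  by rewrite inE => /andP[].
rewrite card_cols // GJ leqnn andbT; apply/subsetP => _ /imsetP[c /GIJ + ->].
by rewrite inE => /andP[].
Qed.

Lemma uniq3C (T : eqType) (a b c : T) : uniq [:: a; b; c] -> uniq [:: a; c; b].
Proof. by rewrite /= !inE !negb_or [c == b]eq_sym !andbT => /andP[/andP[-> ->] ->]. Qed.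

Lemma in3C (T : eqType) (a b c : T) (p : T -> Prop) :
  {in [:: a; b; c], forall t, p t} -> {in [:: a; c; b], forall t, p t}.
Proof.
by move=> H t; rewrite !inE => /or3P[] tE; apply: H; rewrite !inE tE ?orbT.
Qed.

Section Small.

Variables (P Q : finType) (f : P -> Q -> 'I_3) (x y z : 'I_3) (I : {set P}) (J : {set Q}).
Hypotheses (yz : y != z) (xy : x != y) (xz : x != z).
Hypotheses (freq : frequency f 2) (gad : gadget f z I J).
Variables (i0 : P) (j0 : Q) (i1 : P) (j1 : Q).
Hypotheses (i0I : i0 \in I) (j0J : j0 \in J) (i1I : i1 \in I) (j1J : j1 \in J).
Hypothesis f00 : f i0 j0 = y.
Hypothesis onlyy : forall i j, i \in I -> j \in J -> f i j = y -> i = i0 /\ j = j0.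
Hypothesis fourz : #|[set c in setX I J | f c.1 c.2 == z]| = 4.
(** The conclusion of [minor_free] for the array and, in [freeJ], for its transpose. *)
Hypothesis freeI : forall j j2 j3 i2 i3, uniq [:: i1; i2; i3] -> {in [:: i1; i2; i3], forall i, i \in I} ->
  uniq [:: j; j2; j3] -> {in [:: j; j2; j3], forall j, j \in J} ->
  {in I, forall i, f i j != y} -> ~ (f i2 j2 = x /\ f i3 j3 = z).
Hypothesis freeJ : forall i i2 i3 j2 j3, uniq [:: j1; j2; j3] -> {in [:: j1; j2; j3], forall j, j \in J} ->
  uniq [:: i; i2; i3] -> {in [:: i; i2; i3], forall i, i \in I} ->
  {in J, forall j, f i j != y} -> ~ (f i2 j2 = x /\ f i3 j3 = z).

Lemma small_xz i j : i \in I -> j \in J -> (i != i0) || (j != j0) -> f i j = x \/ f i j = z.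
Proof.
move=> iI jJ ne; have fy : f i j != y.
  by apply: contraTneq ne => /(onlyy iI jJ)[-> ->]; rewrite !eqxx.
by have [|ny] := eqVneq (f i j) z; [right|left; apply: (@I3_third y z x)]; rewrite // eq_sym.
Qed.

Lemma small_pair i2 i3 j2 j3 : i2 \in I -> i3 \in I -> j2 \in J -> j3 \in J ->
  (i2 != i0) || (j2 != j0) -> (i3 != i0) || (j3 != j0) ->
  ~ (f i2 j2 = x /\ f i3 j3 = z) -> ~ (f i3 j3 = x /\ f i2 j2 = z) -> f i2 j2 = f i3 j3.
Proof.
move=> i2I i3I j2J j3J n2 n3 H2 H3.
have [E2|E2] := small_xz i2I j2J n2; have [E3|E3] := small_xz i3I j3J n3; rewrite E2 E3 //.
  by case: H2.
by case: H3.
Qed.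

(** Off [(i0, j0)] the gadget has only [x] and [z], and [freeI] forbids one of each, in either
    order, on a diagonal of the minor without row [i1] and column [j]. *)
Lemma small_eqI j i2 i3 j2 j3 : uniq [:: i1; i2; i3] -> {in [:: i1; i2; i3], forall i, i \in I} ->
  uniq [:: j; j2; j3] -> {in [:: j; j2; j3], forall j, j \in J} -> j != j0 ->
  (i2 != i0) || (j2 != j0) -> (i3 != i0) || (j3 != j0) -> f i2 j2 = f i3 j3.
Proof.
move=> ui iI uj jJ jj0 n2 n3; have Hj : {in I, forall i, f i j != y}.
  by move=> i iI'; apply: contraNneq jj0 => /(onlyy iI' (jJ _ (mem_head _ _)))[_ ->].
apply: small_pair => //; rewrite ?iI ?jJ ?inE ?eqxx ?orbT //; first exact: freeI ui iI uj jJ Hj.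
exact: freeI (uniq3C ui) (in3C iI) (uniq3C uj) (in3C jJ) Hj.
Qed.

Lemma small_eqJ i i2 i3 j2 j3 : uniq [:: j1; j2; j3] -> {in [:: j1; j2; j3], forall j, j \in J} ->
  uniq [:: i; i2; i3] -> {in [:: i; i2; i3], forall i, i \in I} -> i != i0 ->
  (i2 != i0) || (j2 != j0) -> (i3 != i0) || (j3 != j0) -> f i2 j2 = f i3 j3.
Proof.
move=> uj jJ ui iI ii0 n2 n3; have Hi : {in J, forall j, f i j != y}.
  by move=> j jJ'; apply: contraNneq ii0 => /(onlyy (iI _ (mem_head _ _)) jJ')[-> _].
apply: small_pair => //; rewrite ?iI ?jJ ?inE ?eqxx ?orbT //; first exact: freeJ uj jJ ui iI Hi.
exact: freeJ (uniq3C uj) (in3C jJ) (uniq3C ui) (in3C iI) Hi.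
Qed.

Lemma uniq_leq_card (T : finType) (A : {set T}) (t : seq T) :
  uniq t -> {in t, forall u, u \in A} -> size t <= #|A|.
Proof. by move=> /card_uniqP <- tA; apply/subset_leq_card/subsetP. Qed.

(** The gadget diagonal for [x] consists of [(i0, j0)] and two [z]-cells [(a, d)], [(b, e)]. The
    conditions on minors make the four other cells of row [i0] and column [j0] equal. The gadget
    diagonal for [y] avoids [(i0, j0)], hence passes through two of these four, and only [z] occurs
    twice on it. This gives six [z]-cells instead of four. *)
Lemma small_contra : False.
Proof.
have [cI cJ diag] := gad.
have cG e G : (forall s, cnt f s G + (s == e) = 1 + (s == z)) -> #|G| = 3.
  move=> cG; have : \sum_s (cnt f s G + (s == e)) = \sum_s (1 + (s == z)) by apply: eq_bigr.
  rewrite !big_split /= cnt_sum sum_nat_const card_ord (bigD1 e) //= eqxx big1 => [|s /negPf->//].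
  by rewrite (bigD1 z) //= eqxx big1 => [|s /negPf->//]; clear; lia.
have lines e G : matching G -> G \subset setX I J ->
    (forall s, cnt f s G + (s == e) = 1 + (s == z)) -> rows G = I /\ cols G = J.
  by move=> mG GIJ /cG G3; apply: card_nonconflict; rewrite ?cI ?cJ.
have row3 i ja jb jc s : uniq [:: ja; jb; jc] -> f i ja = s -> f i jb = s -> f i jc = s -> False.
  move=> u fa fb fc; have := freq.1 i s; apply/eqP; rewrite eqn_leq negb_and -ltnNge.
  apply/orP; left; apply: (@uniq_leq_card _ _ [:: ja; jb; jc]) => // q.
  by rewrite !inE => /or3P[] /eqP->; apply/eqP.
have col3 j ia ib ic s : uniq [:: ia; ib; ic] -> f ia j = s -> f ib j = s -> f ic j = s -> False.
  move=> u fa fb fc; have := freq.2 j s; apply/eqP; rewrite eqn_leq negb_and -ltnNge.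
  apply/orP; left; apply: (@uniq_leq_card _ _ [:: ia; ib; ic]) => // q.
  by rewrite !inE => /or3P[] /eqP->; apply/eqP.
have [a [b [d [e [uI uJ [inI inJ fad fbe]]]]]] : exists a b d e, [/\ uniq [:: i0; a; b],
    uniq [:: j0; d; e], {in [:: i0; a; b], forall i, i \in I} /\ {in [:: j0; d; e], forall j, j \in J},
    f a d = z & f b e = z].
  have [G [mG GIJ cGx]] := diag x.
  have z2 : #|[set c in G | f c.1 c.2 == z]| == 2.
    by have := cGx z; rewrite eqxx eq_sym (negPf xz) addn0 => /eqP.
  have [[a d] [[b e] [ne Ez]]] := cards2P _ z2.
  have : 0 < cnt f y G.
    by have := cGx y; rewrite eq_sym (negPf xy) (negPf yz) addn0 => ->.
  rewrite card_gt0 => /set0Pn[[i j]]; rewrite inE /= => /andP[ijG /eqP fy].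
  have : (i, j) \in setX I J by apply: (subsetP GIJ).
  rewrite inE /= => /andP[iI jJ]; have [Ei Ej] := onlyy iI jJ fy; subst i j.
  have : (a, d) \in [set c in G | f c.1 c.2 == z] by rewrite Ez !inE eqxx.
  rewrite inE /= => /andP[adG /eqP fad].
  have : (b, e) \in [set c in G | f c.1 c.2 == z] by rewrite Ez !inE eqxx orbT.
  rewrite inE /= => /andP[beG /eqP fbe].
  have := matchingP _ mG _ _ adG beG; have := matchingP _ mG _ _ ijG adG.
  have := matchingP _ mG _ _ ijG beG; rewrite /conflict /= => H1 H2 H3.
  have n1 : ~~ ((i0 == b) || (j0 == e)).
    by apply/negP => /H1[E1 E2]; move: yz; rewrite -f00 E1 E2 fbe eqxx.
  have n2 : ~~ ((i0 == a) || (j0 == d)).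
    by apply/negP => /H2[E1 E2]; move: yz; rewrite -f00 E1 E2 fad eqxx.
  have n3 : ~~ ((a == b) || (d == e)).
    by apply/negP => /H3[E1 E2]; move: ne; rewrite E1 E2 eqxx.
  move: n1 n2 n3; rewrite !negb_or => /andP[n1 n1'] /andP[n2 n2'] /andP[n3 n3'].
  have /setXP[aI dJ] := subsetP GIJ _ adG; have /setXP[bI eJ] := subsetP GIJ _ beG.
  exists a, b, d, e; split=> //=; rewrite ?inE ?negb_or ?n1 ?n2 ?n3 ?n1' ?n2' ?n3' //.
  by split=> u; rewrite !inE => /or3P[] /eqP->.
have listI i : i \in I -> i = i0 \/ (i = a \/ i = b).
  move=> iI; have : i \in [:: i0; a; b].
    apply/negPn/negP => ni; have : 4 <= #|I|.
      apply: (@uniq_leq_card _ _ [:: i, i0, a, b & [::]]); first by rewrite cons_uniq ni.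
      by move=> u; rewrite inE => /predU1P[->//|]; apply: inI.
    by rewrite cI.
  by rewrite !inE => /or3P[] /eqP->; auto.
have listJ j : j \in J -> j = j0 \/ (j = d \/ j = e).
  move=> jJ; have : j \in [:: j0; d; e].
    apply/negPn/negP => nj; have : 4 <= #|J|.
      apply: (@uniq_leq_card _ _ [:: j, j0, d, e & [::]]); first by rewrite cons_uniq nj.
      by move=> u; rewrite inE => /predU1P[->//|]; apply: inJ.
    by rewrite cJ.
  by rewrite !inE => /or3P[] /eqP->; auto.
have mI i : i = i0 \/ (i = a \/ i = b) -> i \in I.
  by case=> [->|[->|->]]; apply: inI; rewrite !inE eqxx ?orbT.
have mJ j : j = j0 \/ (j = d \/ j = e) -> j \in J.
  by case=> [->|[->|->]]; apply: inJ; rewrite !inE eqxx ?orbT.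
have [na nb nab] : [/\ a != i0, b != i0 & a != b].
  by move: uI; rewrite /= !inE !negb_or !(eq_sym i0) andbT => /andP[/andP[]].
have [nd ne nde] : [/\ d != j0, e != j0 & d != e].
  by move: uJ; rewrite /= !inE !negb_or !(eq_sym j0) andbT => /andP[/andP[]].
have inI3 i i' i'' : uniq [:: i; i'; i''] -> i \in I -> i' \in I -> i'' \in I ->
    {in [:: i; i'; i''], forall i, i \in I}.
  by move=> _ h h' h'' u; rewrite !inE => /or3P[] /eqP->.
have inJ3 j j' j'' : uniq [:: j; j'; j''] -> j \in J -> j' \in J -> j'' \in J ->
    {in [:: j; j'; j''], forall j, j \in J}.
  by move=> _ h h' h'' u; rewrite !inE => /or3P[] /eqP->.
have eqI j i2 i3 j2 j3 : uniq [:: i1; i2; i3] -> i2 \in I -> i3 \in I ->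
    uniq [:: j; j2; j3] -> j \in J -> j2 \in J -> j3 \in J ->
    j != j0 -> (i2 != i0) || (j2 != j0) -> (i3 != i0) || (j3 != j0) -> f i2 j2 = f i3 j3.
  by move=> u h2 h3 v g1 g2 g3; apply: small_eqI u (inI3 _ _ _ u i1I h2 h3) v (inJ3 _ _ _ v g1 g2 g3).
have eqJ i i2 i3 j2 j3 : uniq [:: j1; j2; j3] -> j2 \in J -> j3 \in J ->
    uniq [:: i; i2; i3] -> i \in I -> i2 \in I -> i3 \in I ->
    i != i0 -> (i2 != i0) || (j2 != j0) -> (i3 != i0) || (j3 != j0) -> f i2 j2 = f i3 j3.
  by move=> u h2 h3 v g1 g2 g3; apply: small_eqJ u (inJ3 _ _ _ u j1J h2 h3) v (inI3 _ _ _ v g1 g2 g3).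
have aI : a \in I by auto. have bI : b \in I by auto.
have dJ : d \in J by auto. have eJ : e \in J by auto.
have nI : [/\ i0 != a, i0 != b & b != a] by rewrite !(eq_sym i0) (eq_sym b a).
have nJ : [/\ j0 != d, j0 != e & e != d] by rewrite !(eq_sym j0) (eq_sym e d).
case: nI nJ => na' nb' nba [nd' ne' ned].
have sI := (negPf na, negPf nb, negPf nab, negPf na', negPf nb', negPf nba).
have sJ := (negPf nd, negPf ne, negPf nde, negPf nd', negPf ne', negPf ned).
(* The three possible places of [i1], then of [j1], are examined. The cases [i1 = i0] and [j1 = j0]
   produce a line with three [z], against [lambda = 2]. *)
have armI : [/\ f a j0 = f b j0, f i0 d = f a j0 & f i0 e = f a j0].
  have armsI : f i0 d = f i0 e /\ (f i0 d = f b j0 \/ f i0 d = f a j0).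
    case: (listI _ i1I) => [|[]] Ei; rewrite Ei in eqI.
    - have E1 : f a j0 = f b e by apply: (eqI d); rewrite /= ?inE ?sI ?sJ ?orbT.
      have E2 : f a d = f b j0 by apply: (eqI e); rewrite /= ?inE ?sI ?sJ ?orbT.
      have E3 : f a j0 = f b d by apply: (eqI e); rewrite /= ?inE ?sI ?sJ ?orbT.
      by case: (row3 b j0 d e z uJ); rewrite -?E2 -?E3 ?E1.
    - have E1 : f i0 d = f b j0 by apply: (eqI e); rewrite /= ?inE ?sI ?sJ ?orbT.
      have E2 : f i0 e = f b j0 by apply: (eqI d); rewrite /= ?inE ?sI ?sJ ?orbT.
      by rewrite E1 E2; auto.
    have E1 : f i0 d = f a j0 by apply: (eqI e); rewrite /= ?inE ?sI ?sJ ?orbT.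
    have E2 : f i0 e = f a j0 by apply: (eqI d); rewrite /= ?inE ?sI ?sJ ?orbT.
    by rewrite E1 E2; auto.
  have armsJ : f a j0 = f b j0.
    case: (listJ _ j1J) => [|[]] Ej; rewrite Ej in eqJ.
    - have E1 : f i0 d = f b e by apply: (eqJ a); rewrite /= ?inE ?sI ?sJ ?orbT.
      have E3 : f i0 e = f b d by apply: (eqJ a); rewrite /= ?inE ?sI ?sJ ?orbT.
      have E2 : f i0 e = f a d by apply: (eqJ b); rewrite /= ?inE ?sI ?sJ ?orbT.
      by case: (col3 d i0 a b z uI); rewrite -?E3 ?E2 ?E1.
    - have <- : f i0 e = f b j0 by apply: (eqJ a); rewrite /= ?inE ?sI ?sJ ?orbT.
      by symmetry; apply: (eqJ b); rewrite /= ?inE ?sI ?sJ ?orbT.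
    have <- : f i0 d = f b j0 by apply: (eqJ a); rewrite /= ?inE ?sI ?sJ ?orbT.
    by symmetry; apply: (eqJ b); rewrite /= ?inE ?sI ?sJ ?orbT.
  by case: armsI => <- [] ->; rewrite armsJ.
case: armI => Eb Ed Ee.
have [G [mG GIJ cGy]] := diag y; have [rG kG] := lines _ _ mG GIJ cGy.
have y0 : cnt f y G = 0 by have := cGy y; rewrite eqxx (negPf yz); clear; lia.
have noty c : c \in G -> f c.1 c.2 != y.
  by move=> cG'; apply: contra_eqN y0 => fc; rewrite -lt0n card_gt0; apply/set0Pn; exists c; rewrite inE cG'.
have /imsetP[u uG u1] : i0 \in rows G by rewrite rG.
have /imsetP[v vG v2] : j0 \in cols G by rewrite kG.
have fu : f u.1 u.2 = f a j0.
  have := subsetP GIJ _ uG; rewrite inE => /andP[_ u2J]; have := noty _ uG; rewrite -u1.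
  by case: (listJ _ u2J) => [|[]] -> //; rewrite f00 eqxx.
have fv : f v.1 v.2 = f a j0.
  have := subsetP GIJ _ vG; rewrite inE => /andP[v1I _]; have := noty _ vG; rewrite -v2.
  by case: (listI _ v1I) => [|[]] -> //; rewrite f00 eqxx.
have uv : u != v.
  by apply: contraNneq (noty _ uG) => E; rewrite -u1 E -v2 f00.
have c2 : 2 <= cnt f (f a j0) G.
  apply: (@uniq_leq_card _ _ [:: u; v]); first by rewrite /= inE uv.
  by move=> c; rewrite !inE => /orP[] /eqP->; rewrite ?uG ?vG ?fu ?fv eqxx.
have fz : f a j0 = z.
  apply/eqP; apply: contraLR c2 => nz; have := cGy (f a j0); rewrite (negPf nz) -leqNgt.
  by clear; lia.
have : 6 <= #|[set c in setX I J | f c.1 c.2 == z]|.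
  apply: (@uniq_leq_card _ _ [:: (a, d); (b, e); (a, j0); (b, j0); (i0, d); (i0, e)]).
    by rewrite /= !inE !xpair_eqE !sI !sJ ?andbF ?eqxx.
  move=> c; rewrite !inE => /or4P[/eqP->|/eqP->|/eqP->|/or3P[/eqP->|/eqP->|/eqP->]] /=.
  - by rewrite aI dJ fad eqxx.
  - by rewrite bI eJ fbe eqxx.
  - by rewrite aI j0J fz eqxx.
  - by rewrite bI j0J -Eb fz eqxx.
  - by rewrite i0I dJ Ed fz eqxx.
  by rewrite i0I eJ Ee fz eqxx.
by rewrite fourz.
Qed.

End Small.

Lemma uniq3_of_card (T : finType) (a : T) : #|T| = 3 -> exists b c, uniq [:: a; b; c].
Proof.
move=> cT; have c2 : #|[set~ a]| == 2 by rewrite cardsC1 cT.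
have [b [c [bc E]]] := cards2P _ c2; exists b, c.
have : b \in [set~ a] by rewrite E !inE eqxx.
have : c \in [set~ a] by rewrite E !inE eqxx orbT.
by rewrite /= !inE negb_or bc ![a == _]eq_sym => -> ->.
Qed.

(** * Balanced diagonals of arrays with a gadget *)

Section Assembly.

Variables (P Q : finType) (f : P -> Q -> 'I_3) (z : 'I_3) (I : {set P}) (J : {set Q}).

Lemma balanced_of_gadget_large k : 0 < k -> #|P| = 3 * k.+2 -> #|Q| = 3 * k.+2 ->
  frequency f k.+2 -> gadget f z I J -> has_balanced f k.+2.
Proof.
move=> k0 cP cQ freq gad; apply: (balanced_of_exact cP cQ gad).
exact: exact_exists z (card_restP cP gad) (card_restQ cQ gad) (rest_rows J freq) (rest_cols I freq)
  (rest_color_total cP freq gad) k0.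
Qed.

Lemma balanced_of_gadget_small : #|P| = 6 -> #|Q| = 6 -> frequency f 2 -> gadget f z I J ->
  has_balanced f 2.
Proof.
move=> cP cQ freq gad; have [//|nb] := balanced_dec f 2; exfalso.
have [cI cJ _] := gad; pose g := rest f (I := I) (J := J).
have cP' : #|{: {p : P | p \notin I}}| = 3 by rewrite (card_restP (cP : _ = 3 * 0.+2) gad).
have cQ' : #|{: {q : Q | q \notin J}}| = 3 by rewrite (card_restQ (cQ : _ = 3 * 0.+2) gad).
have [ex|nex] := exact_dec g 0 z; first by apply: nb; apply: (@balanced_of_exact _ _ f 0 z I J).
have tot := @rest_color_total _ _ _ 0 _ _ _ cP freq gad.
have [y [r [c [yz gy gz gr gc]]]] :=
  @rest_cross _ _ g 0 z cP' cQ' (rest_rows J freq) (rest_cols I freq) tot (erefl _) nex.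
have [p1 [p2 uP]] := uniq3_of_card r cP'; have [q1 [q2 uQ]] := uniq3_of_card c cQ'.
have [n1 n2 n3] : [/\ p1 != r, p2 != r & p2 != p1].
  by move: uP; rewrite /= !inE negb_or !(eq_sym r) andbT (eq_sym p1 p2) => /andP[/andP[]].
have [m1 m2 m3] : [/\ q1 != c, q2 != c & q2 != q1].
  by move: uQ; rewrite /= !inE negb_or !(eq_sym c) andbT (eq_sym q1 q2) => /andP[/andP[]].
pose x := g r q1; have [xy xz] := gc _ m1; rewrite -/x in xy xz.
have gx p : p != r -> g p c = x.
  move=> /gr[h1 h2]; apply: (@I3_third y z x) => //; by rewrite eq_sym.
have uPv : uniq [:: val r; val p1; val p2] by rewrite (map_inj_uniq val_inj [:: r; p1; p2]).
have uQv : uniq [:: val c; val q1; val q2] by rewrite (map_inj_uniq val_inj [:: c; q1; q2]).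
have nP : {in [:: val r; val p1; val p2], forall p, p \notin I}.
  by move=> p; rewrite !inE => /or3P[] /eqP->; [apply: (valP r)|apply: (valP p1)|apply: (valP p2)].
have nQ : {in [:: val c; val q1; val q2], forall q, q \notin J}.
  by move=> q; rewrite !inE => /or3P[] /eqP->; [apply: (valP c)|apply: (valP q1)|apply: (valP q2)].
have freq' : frequency (fun q p => f p q) 2 by split; [apply: freq.2 | apply: freq.1].
have z11 := gz _ _ n1 m1; have z12 := gz _ _ n1 m2.
have z21 := gz _ _ n2 m1; have z22 := gz _ _ n2 m2.
have [i1 i1I freeI] := minor_free yz xy xz cP freq cI uPv uQv nP nQ gy (erefl _) z11 z12 z21 z22 nb.
have nb' : ~ has_balanced (fun q p => f p q) 2 by move=> h; apply: nb; apply: balanced_tr h.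
have [j1 j1J freeJ] := @minor_free _ _ (fun q p => f p q) _ _ _ _ I
  yz xy xz cQ freq' cJ _ _ _ _ _ _ uQv uPv nQ nP gy (gx _ n1) z11 z21 z12 z22 nb'.
(* For [lambda = 2] both [#|P| * l] and [(#|I| + #|J|) * l] are 12, so the gadget has as many cells
   of each colour as the rest: one [y] and four [z]. *)
have toty := rest_total I J freq y; have totz := rest_total I J freq z.
have cy : #|[set d | g d.1 d.2 == y]| = 1.
  rewrite (_ : [set d | _] = [set (r, c)]) ?cards1 //.
  apply/setP => -[p q]; rewrite !inE /= xpair_eqE.
  have [->|pr] := eqVneq p r; last first.
    have [->|qc] := eqVneq q c; first by rewrite (gx _ pr) (negPf xy).
    by rewrite gz // eq_sym (negPf yz).
  have [->|qc] := eqVneq q c; first by rewrite gy eqxx.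
  by have [h _] := gc _ qc; rewrite (negPf h).
have cz : #|[set d | g d.1 d.2 == z]| = 4.
  rewrite (_ : [set d | _] = setX [set~ r] [set~ c]) ?cardsX ?cardsC1 ?cP' ?cQ' //.
  apply/setP => -[p q]; rewrite !inE /=.
  have [->|pr] := eqVneq p r; last first.
    have [->|qc] := eqVneq q c; first by rewrite (gx _ pr) (negPf xz).
    by rewrite gz // eqxx.
  have [->|qc] := eqVneq q c; first by rewrite gy (negPf yz).
  by have [_ h] := gc _ qc; rewrite (negPf h).
move: toty totz; rewrite cy cz cP cI cJ => toty totz.
have y1 : #|[set c in setX I J | f c.1 c.2 == y]| == 1 by move: toty; clear; lia.
have z4 : #|[set c in setX I J | f c.1 c.2 == z]| = 4 by move: totz; clear; lia.
have [[i0 j0] E] := cards1P y1.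
have : (i0, j0) \in [set c in setX I J | f c.1 c.2 == y] by rewrite E inE.
rewrite !inE /= => /andP[/andP[i0I j0J] /eqP f00].
apply: (small_contra yz xy xz freq gad i0I j0J i1I j1J f00 _ z4) => [i j iI jJ fij||].
- have : (i, j) \in [set c in setX I J | f c.1 c.2 == y] by rewrite !inE /= iI jJ fij eqxx.
  by rewrite E inE => /eqP[-> ->].
- by move=> j j2 j3 i2 i3 u iI v jJ; apply: freeI.
by move=> i i2 i3 j2 j3 u jJ v iI; apply: freeJ.
Qed.

End Assembly.

(** * Arrays without a gadget *)

Definition perms3 := [:: [:: 0; 1; 2]; [:: 0; 2; 1]; [:: 1; 0; 2]; [:: 1; 2; 0]; [:: 2; 0; 1]; [:: 2; 1; 0]].
Definition colors3 := [:: 0; 1; 2].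
Definition column_types :=
  [seq [:: x; y.1; y.2] | x <- colors3, y <- [seq (u, v) | u <- colors3, v <- colors3]].

Definition diagonal_colors (t u v p : seq nat) :=
  [:: nth 0 t (nth 0 p 0); nth 0 u (nth 0 p 1); nth 0 v (nth 0 p 2)].

(* Injective on multisets of three colours. *)
Definition weight s := if s is 2 then 4 else s.

(** The code [5] means three different colours. The two other diagonals of a gadget for [z] have
    codes [5 + weight z - weight e] with [e] different from [z]: [1, 4] for [z = 0], [2, 6] for
    [z = 1] and [8, 9] for [z = 2]. *)
Definition gadget_types t u v :=
  let c := [seq let: d := diagonal_colors t u v p in
    weight (nth 0 d 0) + weight (nth 0 d 1) + weight (nth 0 d 2) | p <- perms3] in
  has (eqn 5) c && has (fun m => has (eqn m.1) c && has (eqn m.2) c) [:: (1, 4); (2, 6); (8, 9)].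

Definition shifted (A : seq (seq nat)) :=
  has (fun p => has (fun d => all (fun t =>
    (nth 0 t (nth 0 p 1) == (nth 0 t (nth 0 p 0) + d) %% 3) &&
    (nth 0 t (nth 0 p 2) != nth 0 t (nth 0 p 1))) A) [:: 1; 2]) perms3.

Definition rules := [seq (ij, ss) | ij <- [:: (0, 1); (0, 2); (1, 0); (1, 2); (2, 0); (2, 1)],
  ss <- [seq (u, v) | u <- colors3, v <- colors3]].

(* Since every colour occurs equally often in all rows, the columns with colour [s] in row [i]
   cannot strictly contain those with colour [s'] in row [j]: if some column is [inside] the rule
   [(i, j, (s, s'))], then some column is [outside] it. *)
Definition inside (r : nat * nat * (nat * nat)) (t : seq nat) :=
  (nth 0 t r.1.1 == r.2.1) && (nth 0 t r.1.2 != r.2.2).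
Definition outside (r : nat * nat * (nat * nat)) (t : seq nat) :=
  (nth 0 t r.1.2 == r.2.2) && (nth 0 t r.1.1 != r.2.1).

(** Only pairs containing the new type [e] are tested; pairs within [W] were tested when [W] was
    built. *)
Definition compatible e W t :=
  (t \in e :: W) || all (fun b => (b == e) || ~~ gadget_types t e b) W.

(* [W]: column types known to occur; [A]: all types that may occur. *)
Fixpoint search fuel W A := if fuel is n.+1 then
  let next e := search n (e :: W) [seq t <- A | compatible e W t] in
  shifted A ||
  if [seq r <- rules | has (inside r) W && ~~ has (outside r) W] is r :: _
  then all next [seq e <- A | outside r e]
  else shifted W && all (fun e => (e \in W) || next e) A
  else false.

(** The initial type [[:: 0; 1; 2]] is obtained by ordering three rows by their colours in one
    column. Fuel [6] allows five further types on a branch, and the computation shows that this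
    suffices. *)
Lemma search_true : search 6 [:: [:: 0; 1; 2]] column_types.
Proof. by []. Qed.

Section Search.

Variable T : pred (seq nat).
Hypothesis no_gadget : forall t u v, T t -> T u -> T v -> uniq [:: t; u; v] -> ~~ gadget_types t u v.
Hypothesis rule : forall r t, r \in rules -> T t -> inside r t -> exists2 u, T u & outside r u.

Lemma shiftedP A : shifted A -> (forall t, T t -> t \in A) -> exists p d,
  [/\ p \in perms3, d \in [:: 1; 2] & forall t, T t ->
    nth 0 t (nth 0 p 1) = (nth 0 t (nth 0 p 0) + d) %% 3 /\
    nth 0 t (nth 0 p 2) <> nth 0 t (nth 0 p 1)].
Proof.
case/hasP => p pp /hasP[d dd /allP H] TA; exists p, d; split=> // t /TA/H /andP[/eqP-> /eqP h].
by split.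
Qed.

(** [T] stands for the types that occur. If a rule has an inside but no outside type in [W], [rule]
    yields an outside type in [T], and all candidates were tried. Otherwise either another type
    occurs and is added to [W], or all types of [T] are in [W]. *)
Lemma search_sound n W A : search n W A -> (forall t, t \in W -> T t) ->
  (forall t, T t -> t \in A) -> exists p d,
  [/\ p \in perms3, d \in [:: 1; 2] & forall t, T t ->
    nth 0 t (nth 0 p 1) = (nth 0 t (nth 0 p 0) + d) %% 3 /\
    nth 0 t (nth 0 p 2) <> nth 0 t (nth 0 p 1)].
Proof.
elim: n W A => // n IH W A sW WT TA; move: sW; cbn [search].
have step e : T e -> search n (e :: W) [seq t <- A | compatible e W t] -> exists p d,
  [/\ p \in perms3, d \in [:: 1; 2] & forall t, T t ->
    nth 0 t (nth 0 p 1) = (nth 0 t (nth 0 p 0) + d) %% 3 /\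
    nth 0 t (nth 0 p 2) <> nth 0 t (nth 0 p 1)].
  move=> Te /IH; apply=> [t|t Tt]; first by rewrite inE => /predU1P[->|/WT].
  rewrite mem_filter TA // andbT /compatible; have [//|] := boolP (t \in e :: W).
  rewrite inE negb_or => /andP[te tW]; apply/allP => b bW; have [//|be] := eqVneq b e.
  apply: no_gadget => //; first exact: WT.
  by rewrite /= !inE negb_or te [e == b]eq_sym be !andbT; apply: contraNneq tW => ->.
case/orP => [sA|]; first exact: shiftedP sA TA.
case E : [seq r <- rules | _] => [|r rs].
  case/andP => sW /allP H; have [/hasP[e eA /andP[Te eW]]|no] := boolP (has (fun e => T e && (e \notin W)) A).
    by have := H _ eA; rewrite (negPf eW); apply: step.
  apply: shiftedP sW _ => t Tt; apply: contraNT no => tW; apply/hasP; exists t; rewrite ?TA //.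
  by rewrite Tt.
move=> /allP H; have : r \in r :: rs by rewrite inE eqxx.
rewrite -E mem_filter => /andP[/andP[/hasP[t tW it] _] rr].
have [u Tu ou] := rule rr (WT _ tW) it.
apply: (step _ Tu); apply: (H u); by rewrite mem_filter ou TA.
Qed.

End Search.

Lemma mem_colors3 (s : 'I_3) : val s \in colors3.
Proof. by case: s => [[|[|[|s]]] ?]. Qed.

Lemma colors3P a : a \in colors3 -> [\/ a = 0, a = 1 | a = 2].
Proof. by rewrite !inE => /or3P[] /eqP->; [apply: Or31|apply: Or32|apply: Or33]. Qed.

Lemma weight_counts (a b c e z s : 'I_3) : weight a + weight b + weight c + weight e = 5 + weight z ->
  (a == s) + (b == s) + (c == s) + (s == e) = 1 + (s == z).
Proof.
have : all (fun a => all (fun b => all (fun c => all (fun e => all (fun z => all (fun s =>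
  (weight a + weight b + weight c + weight e == 5 + weight z) ==>
  ((a == s) + (b == s) + (c == s) + (s == e) == 1 + (s == z)))
  colors3) colors3) colors3) colors3) colors3) colors3 by [].
move=> /allP/(_ _ (mem_colors3 a))/allP/(_ _ (mem_colors3 b))/allP/(_ _ (mem_colors3 c)).
move=> /allP/(_ _ (mem_colors3 e))/allP/(_ _ (mem_colors3 z))/allP/(_ _ (mem_colors3 s)).
by move=> /implyP H /eqP/H/eqP; rewrite !val_eqE.
Qed.

Lemma perm2P (T : eqType) (u v a b : T) : perm_eq [:: u; v] [:: a; b] ->
  (u = a /\ v = b) \/ (u = b /\ v = a).
Proof.
have one (x y : T) : perm_eq [:: x] [:: y] -> x = y.
  by move=> /perm_mem/(_ x); rewrite !inE eqxx => /esym/eqP.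
move=> H; have := perm_mem H u; rewrite !inE eqxx => /esym/orP[] /eqP E; move: H; rewrite E.
  by rewrite perm_cons => /one; left.
rewrite perm_sym -(cat1s a) perm_catC perm_cons => /one; by right.
Qed.

Lemma perm3P (T : eqType) (u v w a b c : T) : perm_eq [:: u; v; w] [:: a; b; c] ->
  [\/ u = a /\ (v = b /\ w = c \/ v = c /\ w = b), u = b /\ (v = a /\ w = c \/ v = c /\ w = a)
    | u = c /\ (v = a /\ w = b \/ v = b /\ w = a)].
Proof.
move=> H; have := perm_mem H u; rewrite !inE eqxx => /esym/or3P[] /eqP E; move: H; rewrite E.
- by rewrite perm_cons => /perm2P; auto using Or31.
- rewrite perm_sym -(cat1s a) -(cat1s b) perm_catCA perm_cons perm_sym => /perm2P; auto using Or32.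
rewrite perm_sym (perm_catC [:: a; b] [:: c]) perm_cons perm_sym => /perm2P; auto using Or33.
Qed.

Section Columns.

Variables (P Q : finType) (f : P -> Q -> 'I_3).
Variables r0 r1 r2 : P.
Hypothesis uR : uniq [:: r0; r1; r2].

Definition column_type q : seq nat := [:: val (f r0 q); val (f r1 q); val (f r2 q)].

Lemma gadget_of_types q0 q1 q2 : uniq [:: q0; q1; q2] ->
  gadget_types (column_type q0) (column_type q1) (column_type q2) ->
  exists z, gadget f z [set r in [:: r0; r1; r2]] [set q in [:: q0; q1; q2]].
Proof.
move=> uQ; pose row i := nth r0 [:: r0; r1; r2] i.
pose G p := [:: (row (nth 0 p 0), q0); (row (nth 0 p 1), q1); (row (nth 0 p 2), q2)].
pose code p := weight (f (row (nth 0 p 0)) q0) + weight (f (row (nth 0 p 1)) q1)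
  + weight (f (row (nth 0 p 2)) q2).
rewrite /gadget_types; set c := [seq _ | p <- perms3].
have cP m : has (eqn m) c -> exists2 p, p \in perms3 & code p = m.
  case/hasP => _ /mapP[p pp ->] /eqnP ->; exists p => //; rewrite /code.
  by move: pp; rewrite !inE => /or4P[/eqP->|/eqP->|/eqP->|/or3P[] /eqP->].
suff gad (z : 'I_3) :
    (forall e : 'I_3, exists2 p, p \in perms3 & code p + weight (val e) = 5 + weight (val z)) ->
    gadget f z [set r in [:: r0; r1; r2]] [set q in [:: q0; q1; q2]].
  case/andP => /cP[p pp cp] /hasP[m]; rewrite !inE => /or3P mE /andP[].
  case: mE => /eqP-> /cP[p1 pp1 cp1] /cP[p2 pp2 cp2].
  - exists (inord 0); apply: gad => -[[|[|[|e]]] h] //=; rewrite inordK //;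
      [exists p|exists p2|exists p1]; rewrite ?cp ?cp1 ?cp2 //.
  - exists (inord 1); apply: gad => -[[|[|[|e]]] h] //=; rewrite inordK //;
      [exists p2|exists p|exists p1]; rewrite ?cp ?cp1 ?cp2 //.
  exists (inord 2); apply: gad => -[[|[|[|e]]] h] //=; rewrite inordK //;
      [exists p2|exists p1|exists p]; rewrite ?cp ?cp1 ?cp2 //.
move=> H; split; first by rewrite cardsE (card_uniqP uR).
  by rewrite cardsE (card_uniqP uQ).
move=> e; have [p pp cp] := H e; exists [set d in G p].
have rowp : perm_eq [seq d.1 | d <- G p] [:: r0; r1; r2].
  rewrite /G /row; move: pp; rewrite !inE => /or4P[/eqP->|/eqP->|/eqP->|/or3P[] /eqP->] /=;
  by apply/permP => a /=; clear; lia.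
have uG1 : uniq [seq d.1 | d <- G p] by rewrite (perm_uniq rowp).
split.
- by apply: matching_seq.
- apply/subsetP => d; rewrite [X in is_true X -> _]inE => dG; rewrite !inE; apply/andP; split.
    by have := map_f fst dG; rewrite (perm_mem rowp) !inE.
  by have := map_f snd dG; rewrite /= !inE.
by move=> s; rewrite cnt_seq //= addn0 !addnA; apply: weight_counts.
Qed.

End Columns.

(** * Latin triples of rows *)

Section LatinRows.

Variables (P Q : finType) (f : P -> Q -> 'I_3) (l : nat).
Hypothesis freq : frequency f l.
Hypothesis no_gadget : forall z (I : {set P}) (J : {set Q}), ~ gadget f z I J.

Definition shift d u v := forall q, (f v q : nat) = (f u q + d) %% 3.
Definition apart u v := forall q, f u q != f v q.

Lemma row_types_rule r0 r1 r2 r q : r \in rules -> inside r (column_type f r0 r1 r2 q) ->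
  exists q', outside r (column_type f r0 r1 r2 q').
Proof.
move=> rr; pose row i := nth r0 [:: r0; r1; r2] i.
have : all (fun r : nat * nat * (nat * nat) =>
    [&& r.1.1 \in colors3, r.1.2 \in colors3, r.2.1 < 3 & r.2.2 < 3]) rules by [].
case: r rr => -[i j] [s s'] rr /allP/(_ _ rr)/and4P[/= iI jJ s3 s3'].
have rowE k q' : k \in colors3 -> nth 0 (column_type f r0 r1 r2 q') k = f (row k) q'.
  by rewrite !inE => /or3P[] /eqP->.
rewrite /inside /outside /= !rowE // => /andP[fi fj].
rewrite -[s]/(val (Ordinal s3)) -[s']/(val (Ordinal s3')) in fi fj *.
move: (Ordinal s3) (Ordinal s3') fi fj => {s3 s3' rr} {s s'} s s'.
rewrite !val_eqE => fi /negP fj.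
have [/existsP[q' H]|H] := boolP [exists q', (f (row j) q' == s') && (f (row i) q' != s)].
  by exists q'; rewrite !rowE // !val_eqE.
have /eqP E : [set q | f (row j) q == s'] == [set q | f (row i) q == s].
  rewrite eqEcard (freq.1 _ s) (freq.1 _ s') leqnn andbT; apply/subsetP => q'; rewrite !inE => h.
  by apply: contraNT H => h'; apply/existsP; exists q'; rewrite h.
have : q \in [set q | f (row i) q == s] by rewrite inE fi.
by rewrite -E inE.
Qed.

Lemma shift_triple_sorted r0 r1 r2 q : val (f r0 q) = 0 -> val (f r1 q) = 1 -> val (f r2 q) = 2 ->
  exists u v w d, [/\ perm_eq [:: u; v; w] [:: r0; r1; r2], d \in [:: 1; 2], shift d u v & apart w v].
Proof.
move=> f0 f1 f2; pose ct := column_type f r0 r1 r2; pose row i := nth r0 [:: r0; r1; r2] i.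
have uR : uniq [:: r0; r1; r2].
  rewrite /= !inE negb_or !andbT -andbA; apply/and3P; split; apply/eqP => E.
  - by move: f1; rewrite -E f0.
  - by move: f2; rewrite -E f0.
  by move: f2; rewrite -E f1.
have ctq : ct q = [:: 0; 1; 2] by rewrite /ct /column_type f0 f1 f2.
pose T t := t \in codom ct.
have [p [d [pp dd H]]] : exists p d, [/\ p \in perms3, d \in [:: 1; 2] & forall t, T t ->
    nth 0 t (nth 0 p 1) = (nth 0 t (nth 0 p 0) + d) %% 3 /\
    nth 0 t (nth 0 p 2) <> nth 0 t (nth 0 p 1)].
  apply: (search_sound _ _ search_true).
  - move=> _ _ _ /codomP[q0 ->] /codomP[q1 ->] /codomP[q2 ->] u; apply/negP => g.
    have [|z] := gadget_of_types uR _ g; last exact: no_gadget.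
    by apply: (@map_uniq _ _ ct).
  - move=> r _ rr /codomP[q' ->] /(row_types_rule rr)[q'' o].
    by exists (ct q'') => //; apply: codom_f.
  - by move=> t; rewrite inE => /eqP->; rewrite /T -ctq codom_f.
  move=> _ /codomP[q' ->]; rewrite /ct /column_type.
  by case: (colors3P (mem_colors3 (f r0 q'))) => ->; case: (colors3P (mem_colors3 (f r1 q'))) => ->;
     case: (colors3P (mem_colors3 (f r2 q'))) => ->.
exists (row (nth 0 p 0)), (row (nth 0 p 1)), (row (nth 0 p 2)), d.
have rowE i q' : i \in colors3 -> nth 0 (ct q') i = f (row i) q'.
  by rewrite !inE => /or3P[] /eqP->.
have p0 : [/\ nth 0 p 0 \in colors3, nth 0 p 1 \in colors3 & nth 0 p 2 \in colors3].
  by move: pp; rewrite !inE => /or4P[/eqP->|/eqP->|/eqP->|/or3P[] /eqP->].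
case: p0 => p0 p1 p2; split=> // [|q'|q'].
- rewrite /row; move: pp; rewrite !inE => /or4P[/eqP->|/eqP->|/eqP->|/or3P[] /eqP->];
  by apply/permP => a /=; clear; lia.
- by have [+ _] := H _ (codom_f ct q'); rewrite !rowE.
by have [_ +] := H _ (codom_f ct q'); rewrite !rowE // => /eqP.
Qed.

Lemma sort_colors (r0 r1 r2 : P) q : uniq [:: f r0 q; f r1 q; f r2 q] -> exists a0 a1 a2,
  [/\ perm_eq [:: a0; a1; a2] [:: r0; r1; r2], val (f a0 q) = 0, val (f a1 q) = 1 & val (f a2 q) = 2].
Proof.
rewrite -(map_inj_uniq val_inj) /=.
case: (colors3P (mem_colors3 (f r0 q))) => e0; case: (colors3P (mem_colors3 (f r1 q))) => e1;
  case: (colors3P (mem_colors3 (f r2 q))) => e2; rewrite e0 e1 e2 // => _.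
- by exists r0, r1, r2; split.
- by exists r0, r2, r1; split=> //; apply/permP => a /=; clear; lia.
- by exists r1, r0, r2; split=> //; apply/permP => a /=; clear; lia.
- by exists r2, r0, r1; split=> //; apply/permP => a /=; clear; lia.
- by exists r1, r2, r0; split=> //; apply/permP => a /=; clear; lia.
by exists r2, r1, r0; split=> //; apply/permP => a /=; clear; lia.
Qed.

Lemma shift_triple r0 r1 r2 q : uniq [:: f r0 q; f r1 q; f r2 q] ->
  exists u v w d, [/\ perm_eq [:: u; v; w] [:: r0; r1; r2], d \in [:: 1; 2], shift d u v & apart w v].
Proof.
case/sort_colors => a0 [a1 [a2 [pa f0 f1 f2]]].
have [u [v [w [d [puvw dd s a]]]]] := shift_triple_sorted f0 f1 f2.
by exists u, v, w, d; split=> //; apply: perm_trans puvw pa.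
Qed.

Definition latin u v w := [/\ apart u v, apart u w & apart v w].
Hypothesis no_latin : forall u v w, ~ latin u v w.

Lemma apart_sym u v : apart u v -> apart v u.
Proof. by move=> H q; rewrite eq_sym. Qed.

Lemma shift_apart d u v : d \in [:: 1; 2] -> shift d u v -> apart u v.
Proof.
move=> dd H q; apply/eqP => /(congr1 val) /=; rewrite H; have := ltn_ord (f u q).
by move: dd; rewrite !inE => /orP[] /eqP->; move: (nat_of_ord _) => x; clear; lia.
Qed.

Lemma shift_sym d u v : d \in [:: 1; 2] -> shift d u v -> shift (3 - d) v u.
Proof.
move=> dd H q; rewrite H; have := ltn_ord (f u q).
by move: dd; rewrite !inE => /orP[] /eqP->; move: (nat_of_ord _) => x; clear; lia.
Qed.

(* Two rows that are translates of a common row agree everywhere or nowhere. *)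
Lemma shift_shift d d' u v w q : shift d u v -> shift d' u w -> f v q != f w q -> apart v w.
Proof.
move=> H H' ne q'; move: ne; rewrite -!val_eqE /= !H !H'.
by move: (nat_of_ord (f u q)) (nat_of_ord (f u q')) => x y; clear; lia.
Qed.

Lemma uniq3 (T : eqType) (x y z : T) : x != y -> x != z -> y != z -> uniq [:: x; y; z].
Proof. by move=> xy xz yz; rewrite /= !inE negb_or xy xz yz. Qed.

(** The three rows have three colours in column [c]. Of the pairs among them [shift_triple] makes
    two apart, so at least one apart pair contains [i]. *)
Lemma third_row a b d i c : d \in [:: 1; 2] -> shift d a b ->
  f i c != f a c -> f i c != f b c -> apart i b \/ apart i a.
Proof.
move=> dd sab ia ib; have ab := shift_apart dd sab.
have [|u [v [w [d' [/perm3P puvw dd' suv awv]]]]] := @shift_triple a b i c.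
  by apply: uniq3 => //; rewrite eq_sym.
have auv := shift_apart dd' suv.
case: puvw => -[eu [[ev ew]|[ev ew]]]; move: auv awv; rewrite eu ev ew => auv awv.
- by left.
- by left; apply: apart_sym.
- by right.
- by right; apply: apart_sym.
- by right.
by left.
Qed.

(** Were [i'] apart from [b], the rows [i], [i'], [b] would have three colours in column [c1]. As
    [i] and [i'] are not apart, [shift_triple] makes one of them a translate of [b], like [a]. If it
    is [i], then [i] and [a] agree everywhere or nowhere, against [c0] and [c1]; if it is [i'], then
    [i'], [a], [b] is a Latin triple. *)
Lemma third_row_apart a b d i i' c0 c1 : d \in [:: 1; 2] -> shift d a b ->
  f i c0 != f a c0 -> apart i b -> f i c1 = f a c1 ->
  f i' c1 != f a c1 -> ~ apart i' b.
Proof.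
move=> dd sab ia0 ib ia1 i'a1 i'b; have ab := shift_apart dd sab.
have [|u [v [w [d' [/perm3P puvw dd' suv awv]]]]] := @shift_triple i i' b c1.
  by apply: uniq3 => //; rewrite ia1 eq_sym.
have auv := shift_apart dd' suv; have svu := shift_sym dd' suv; have sba := shift_sym dd sab.
have notlat : ~ apart i i' by move=> ii'; apply: (no_latin (u := i) (v := i') (w := b)).
case: puvw => -[eu [[ev ew]|[ev ew]]]; move: auv awv svu; rewrite eu ev ew => auv awv svu.
- exact: notlat auv.
- by have := shift_shift svu sba ia0 c1; rewrite ia1 eqxx.
- exact: notlat (apart_sym auv).
- apply: (no_latin (u := i') (v := a) (w := b)); split=> //.
  exact: shift_shift svu sba i'a1.
- exact: notlat (apart_sym awv).
exact: notlat awv.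
Qed.

Lemma third_color (x y : 'I_3) : exists z, z != x /\ z != y.
Proof.
have [s [s' [sx s'x ss']]] := other_colors x.
have [E|E] := eqVneq s y; last by exists s.
by exists s'; rewrite s'x -E eq_sym.
Qed.

(** Rows [i] and [a] are apart from [b], so they agree in some column [c1], or there would be a
    Latin triple. A row [j] with the third colour there is not apart from [b], hence apart from [a],
    and agrees with [b] in some column [c2]. Each of the [l] rows with the third colour in [c2] is
    then apart from [b], which forces it to agree with [a] in [c1]; but only [l - 1] rows other than
    [a] do so. *)
Lemma no_shift a b d i c0 : 0 < l -> d \in [:: 1; 2] -> shift d a b ->
  f i c0 != f a c0 -> ~ apart i b.
Proof.
move=> l0 dd sab ia0 ib; have ab := shift_apart dd sab; have sba := shift_sym dd sab.
have dd' : 3 - d \in [:: 1; 2] by move: dd; rewrite !inE => /orP[] /eqP->.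
have meet u v w : apart u v -> apart w v -> exists c, f w c = f u c.
  move=> uv wv; have [/existsP[c /eqP E]|H] := boolP [exists c, f w c == f u c]; first by exists c.
  case: (no_latin (u := w) (v := u) (w := v)); split=> // c.
  by apply: contraNN H => E; apply/existsP; exists c.
have third c : exists2 z, (z != f a c) && (z != f b c) & exists p, f p c = z.
  have [z [za zb]] := third_color (f a c) (f b c); exists z; first by rewrite za.
  have : 0 < #|[set p | f p c == z]| by rewrite freq.2.
  by rewrite card_gt0 => /set0Pn[p]; rewrite inE => /eqP; exists p.
have [c1 ia1] := meet _ _ _ ab ib.
have [z1 /andP[z1a z1b] [j jz]] := third c1; rewrite -jz in z1a z1b.
have jnb := third_row_apart dd sab ia0 ib ia1 z1a.
have ja : apart j a by have [//|] := third_row dd sab z1a z1b.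
have [c2 jb2] := meet _ _ _ (apart_sym ab) ja.
have [z2 /andP[z2a z2b] _] := third c2.
have sub : [set p | f p c2 == z2] \subset [set p | f p c1 == f a c1] :\ a.
  apply/subsetP => p; rewrite !inE => /eqP pz; rewrite -pz in z2a z2b.
  apply/andP; split; first by apply: contraNneq z2a => ->.
  (* Here [a] and [b] are exchanged, and [j] plays the role of [i]. *)
  have pna := third_row_apart dd' sba z1b ja jb2 z2b.
  have pb : apart p b by have [//|] := third_row dd sab z2a z2b.
  by apply/negPn/negP => pa; apply: (third_row_apart dd sab ia0 ib ia1 pa pb).
have := subset_leq_card sub; rewrite freq.2.
by have := freq.2 c1 (f a c1); rewrite (cardsD1 a) inE eqxx; move: #|_| => n; clear; lia.
Qed.

Lemma latin_absurd (q : Q) : 0 < l -> False.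
Proof.
move=> l0; have row s : exists p, f p q = s.
  have : 0 < #|[set p | f p q == s]| by rewrite freq.2.
  by rewrite card_gt0 => /set0Pn[p]; rewrite inE => /eqP; exists p.
have [a fa] := row (inord 0); have [b fb] := row (inord 1); have [c fc] := row (inord 2).
have uabc : uniq [:: f a q; f b q; f c q].
  by apply: uniq3; rewrite ?fa ?fb ?fc -val_eqE /= !inordK.
have [|u [v [w [d [puvw dd suv awv]]]]] := @shift_triple a b c q.
  exact: uabc.
have wu : f w q != f u q.
  have : uniq (map (fun p => f p q) [:: u; v; w]).
    by rewrite (perm_uniq (perm_map _ puvw)).
  by rewrite /= !inE negb_or [f w q == _]eq_sym => /andP[/andP[]].
exact: no_shift l0 dd suv wu awv.
Qed.

End LatinRows.

Lemma latin_rows (P Q : finType) (f : P -> Q -> 'I_3) l (q : Q) : 0 < l -> frequency f l ->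
  (forall z (I : {set P}) (J : {set Q}), ~ gadget f z I J) -> exists u v w, latin f u v w.
Proof.
move=> l0 freq ng; have [/existsP[u /existsP[v /existsP[w /forallP H]]]|H] :=
  boolP [exists u, exists v, exists w, forall q,
    [&& f u q != f v q, f u q != f w q & f v q != f w q]].
  by exists u, v, w; split=> q'; have /and3P[] := H q'.
case: (latin_absurd freq ng _ q l0) => u v w [h1 h2 h3]; apply/negP: H; apply/negPn.
by do 3 (apply/existsP; eexists); apply/forallP => q'; apply/and3P; split; [apply: h1|apply: h2|apply: h3].
Qed.

Lemma gadget_tr (P Q : finType) (f : P -> Q -> 'I_3) z (I : {set P}) (J : {set Q}) :
  gadget (fun q p => f p q) z J I -> gadget f z I J.
Proof.
case=> cJ cI H; split=> // e; have [G [mG /subsetP GJI cG]] := H e.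
exists (tr_cells G); split; first exact: matching_tr.
  apply/subsetP => _ /imsetP[c /GJI + ->]; by rewrite !inE andbC.
by move=> s; rewrite (cnt_tr (fun q p => f p q)).
Qed.

Lemma gadget_dec (P Q : finType) (f : P -> Q -> 'I_3) :
  (exists z I J, gadget f z I J) \/ (forall z (I : {set P}) (J : {set Q}), ~ gadget f z I J).
Proof.
pose gad z (I : {set P}) (J : {set Q}) := [&& #|I| == 3, #|J| == 3 & [forall e : 'I_3,
  exists G : cells P Q, [&& matching G, G \subset setX I J &
    [forall s, cnt f s G + (s == e) == 1 + (s == z)]]]].
have gadP z I J : reflect (gadget f z I J) (gad z I J).
  apply: (iffP and3P) => [[/eqP cI /eqP cJ /forallP H]|[-> -> H]].
    split=> // e; have /existsP[G /and3P[mG sG /forallP cG]] := H e.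
    by exists G; split=> // s; apply/eqP.
  split=> //; apply/forallP => e; have [G [mG sG cG]] := H e.
  by apply/existsP; exists G; rewrite mG sG; apply/forallP => s; rewrite cG.
have [/existsP[z /existsP[I /existsP[J /gadP H]]]|H] :=
  boolP [exists z, exists I, exists J, gad z I J]; first by left; exists z, I, J.
right=> z I J /gadP g; apply/negP: H; rewrite negbK.
by do 3 (apply/existsP; eexists); apply: g.
Qed.

(** In a Latin square of order 3 the three colour classes are the diagonals of one parity, and each
    diagonal of the other parity meets each class once. The two diagonals in the conclusion have
    opposite parities. *)
Lemma latin3_diagonal (m : nat -> nat -> 'I_3) :
  (forall i, i < 3 -> [/\ m i 0 != m i 1, m i 0 != m i 2 & m i 1 != m i 2]) ->
  (forall j, j < 3 -> [/\ m 0 j != m 1 j, m 0 j != m 2 j & m 1 j != m 2 j]) ->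
  (forall s, (m 0 0 == s) + (m 1 1 == s) + (m 2 2 == s) = 1) \/
  (forall s, (m 0 0 == s) + (m 1 2 == s) + (m 2 1 == s) = 1).
Proof.
move=> rowm colm.
have [r00 r01 r02] := rowm 0 isT; have [r10 r11 r12] := rowm 1 isT.
have [r20 r21 r22] := rowm 2 isT; have [c00 c01 c02] := colm 0 isT.
have [c10 c11 c12] := colm 1 isT; have [c20 c21 c22] := colm 2 isT.
have two (p q r s : 'I_3) : p != q -> p != r -> p != s -> q != r -> q != s -> r = s.
  by move=> pq pr ps qr qs; apply: (@I3_third p q s r) => //; rewrite eq_sym.
have [E|N] := eqVneq (m 0 0) (m 1 1).
  right=> s; apply: I3_cover; rewrite ?E // 1?[_ == m 1 1]eq_sym //.
  apply/eqP => E'; move: r02; rewrite (two (m 0 0) (m 1 2) (m 0 1) (m 0 2)) ?eqxx //.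
  - by rewrite E.
  - by rewrite E' eq_sym.
  by rewrite eq_sym.
left=> s; apply: I3_cover => //; apply/eqP => E.
  move: r02; rewrite (two (m 0 0) (m 1 1) (m 0 1) (m 0 2)) ?eqxx //; first by rewrite eq_sym.
  by rewrite E eq_sym.
move: r11; rewrite (two (m 0 0) (m 1 1) (m 1 0) (m 1 2)) ?eqxx //; first by rewrite E eq_sym.
by rewrite eq_sym.
Qed.

(** * Splitting off a Latin square of order 3 *)

Section LatinBlock.

Variables (P Q : finType) (f : P -> Q -> 'I_3) (l : nat).
Hypothesis freq : frequency f l.+1.
Variables (u v w : P) (a b c : Q).
Hypothesis latR : latin f u v w.
Hypothesis latC : latin (fun q p => f p q) a b c.

Local Notation I := [set p in [:: u; v; w]].
Local Notation J := [set q in [:: a; b; c]].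
Local Notation g := (@rest P Q f I J).

Lemma uniq_latin_rows : uniq [:: u; v; w].
Proof.
have [uv uw vw] := latR.
by apply: uniq3; [move: (uv a)|move: (uw a)|move: (vw a)]; apply: contraNneq => ->.
Qed.

Lemma uniq_latin_cols : uniq [:: a; b; c].
Proof.
have [ab ac bc] := latC.
by apply: uniq3; [move: (ab u)|move: (ac u)|move: (bc u)]; apply: contraNneq => ->.
Qed.

Lemma card_block_row p s : #|[set q in [:: a; b; c] | f p q == s]| = 1.
Proof.
have [ab ac bc] := latC; apply: etrans (@I3_cover (f p a) (f p b) (f p c) s (bc p) (ab p) (ac p)).
rewrite (_ : [set q in _ | _] = [set q in filter (fun q => f p q == s) [:: a; b; c]]).
  rewrite cardsE (card_uniqP (filter_uniq _ uniq_latin_cols)) size_filter /= addn0 addnA.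
  by [].
by apply/setP => q; rewrite !inE mem_filter !inE andbC.
Qed.

Lemma card_block_col q s : #|[set p in [:: u; v; w] | f p q == s]| = 1.
Proof.
have [uv uw vw] := latR; apply: etrans (@I3_cover (f u q) (f v q) (f w q) s (vw q) (uv q) (uw q)).
rewrite (_ : [set p in _ | _] = [set p in filter (fun p => f p q == s) [:: u; v; w]]).
  rewrite cardsE (card_uniqP (filter_uniq _ uniq_latin_rows)) size_filter /= addn0 addnA.
  by [].
by apply/setP => p; rewrite !inE mem_filter !inE andbC.
Qed.

(** Every row of the whole array, not only [u], [v], [w], has one cell of each colour in the three
    removed columns, and symmetrically; so each count drops by exactly one. *)
Lemma frequency_rest : frequency g l.
Proof.
split=> [p s|q s]; apply: succn_inj.
  rewrite -(freq.1 (val p) s) -(cardsID J) -(card_imset _ val_inj) -[LHS]add1n; congr (_ + _).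
    apply: etrans (esym (card_block_row (val p) s)) _; apply: eq_card => q; rewrite !inE; exact: andbC.
  apply: eq_card => q; rewrite !inE; apply/imsetP/andP => [[q' + ->]|[qJ fq]].
    by rewrite inE; split=> //; have := valP q'; rewrite !inE.
  have qJ' : q \notin J by rewrite !inE.
  by exists (exist _ q qJ'); rewrite ?inE.
rewrite -(freq.2 (val q) s) -(cardsID I) -(card_imset _ val_inj) -[LHS]add1n; congr (_ + _).
  apply: etrans (esym (card_block_col (val q) s)) _; apply: eq_card => p; rewrite !inE; exact: andbC.
apply: eq_card => p; rewrite !inE; apply/imsetP/andP => [[p' + ->]|[pI fp]].
  by rewrite inE; split=> //; have := valP p'; rewrite !inE.
have pI' : p \notin I by rewrite !inE.
by exists (exist _ p pI'); rewrite ?inE.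
Qed.

Lemma block_diagonal : exists G : cells P Q,
  [/\ matching G, rows G \subset I, cols G \subset J & forall s, cnt f s G = 1].
Proof.
have [uv uw vw] := latR; have [ab ac bc] := latC.
have seq3 q1 q2 q3 : perm_eq [:: q1; q2; q3] [:: a; b; c] ->
    (forall s, (f u q1 == s) + (f v q2 == s) + (f w q3 == s) = 1) -> exists G : cells P Q,
    [/\ matching G, rows G \subset I, cols G \subset J & forall s, cnt f s G = 1].
  move=> pq H; pose cs := [:: (u, q1); (v, q2); (w, q3)].
  have uq : uniq [:: q1; q2; q3] by rewrite (perm_uniq pq) uniq_latin_cols.
  exists [set d in cs]; split.
  - by apply: matching_seq => //; apply: uniq_latin_rows.
  - apply/subsetP => _ /imsetP[d + ->]; rewrite inE => dc.
    by have := map_f fst dc; rewrite inE.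
  - apply/subsetP => _ /imsetP[d + ->]; rewrite inE => dc.
    by have := map_f snd dc; rewrite inE -(perm_mem pq).
  by move=> s; rewrite cnt_seq ?uniq_latin_rows //= addn0 addnA.
have [i _|j _|H|H] := @latin3_diagonal (fun i j => f (nth u [:: u; v; w] i) (nth a [:: a; b; c] j)).
- by split=> /=.
- by split=> /=.
- exact: seq3 (perm_refl _) H.
by apply: seq3 H; rewrite perm_cons (perm_catC [:: c] [:: b]).
Qed.

Lemma balanced_of_rest : has_balanced g l -> has_balanced f l.+1.
Proof.
case=> N mN cN; have [G [mG rG cGJ cG]] := block_diagonal.
have dR : [disjoint rows (lift_cells N) & rows G].
  rewrite disjoint_subset; apply/subsetP => x /(subsetP (lift_avoid N).1).
  by rewrite inE; apply: contra; apply/subsetP.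
have dC : [disjoint cols (lift_cells N) & cols G].
  rewrite disjoint_subset; apply/subsetP => x /(subsetP (lift_avoid N).2).
  by rewrite inE; apply: contra; apply/subsetP.
exists (lift_cells N :|: G); first by apply: matchingU_lines; rewrite ?matching_lift.
by move=> s; rewrite cntU ?disjoint_rows // cnt_lift cN cG addn1.
Qed.

End LatinBlock.

(** * The induction on [lambda] *)

Lemma latin_of_frequency1 (P Q : finType) (f : P -> Q -> 'I_3) u v w :
  frequency f 1 -> uniq [:: u; v; w] -> latin f u v w.
Proof.
move=> freq; have ap x y : x != y -> apart f x y.
  move=> xy q; apply: contraNneq xy => E.
  have /eqP/cards1P[t Et] := freq.2 q (f y q).
  have : x \in [set p | f p q == f y q] by rewrite inE E.
  have : y \in [set p | f p q == f y q] by rewrite inE.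
  by rewrite Et !inE => /eqP-> /eqP->.
by rewrite /= !inE negb_or andbT => /andP[/andP[uv uw] vw]; split; apply: ap.
Qed.

Theorem balanced_of_frequency l (P Q : finType) (f : P -> Q -> 'I_3) :
  #|P| = 3 * l -> #|Q| = 3 * l -> frequency f l -> has_balanced f l.
Proof.
elim: l P Q f => [|l IH] P Q f cP cQ freq.
  exists set0; first exact: matching0.
  by move=> s; apply: eq_card0 => c; rewrite !inE.
have freq' : frequency (fun q p => f p q) l.+1 by split; [apply: freq.2|apply: freq.1].
have by_latin u v w a b c : latin f u v w -> latin (fun q p => f p q) a b c -> has_balanced f l.+1.
  move=> lR lC; apply: (balanced_of_rest lR lC); apply: IH (frequency_rest freq lR lC).
    rewrite card_sub cP cardsE (card_uniqP (uniq_latin_rows a lR)) /=; clear; lia.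
  rewrite card_sub cQ cardsE (card_uniqP (uniq_latin_cols u lC)) /=; clear; lia.
have /card_gt0P[p _] : 0 < #|P| by rewrite cP.
have /card_gt0P[q _] : 0 < #|Q| by rewrite cQ.
have [[z [I [J gad]]]|ng] := gadget_dec f; last first.
  have [u [v [w lR]]] := latin_rows q (ltn0Sn l) freq ng.
  have [z I J /gadget_tr|a [b [c lC]]] := latin_rows p (ltn0Sn l) freq'; first exact: ng.
  exact: by_latin lR lC.
(* For [lambda = 1] any three distinct rows, or columns, form a Latin triple, and the induction
   hypothesis is used for the empty array. *)
case: l => [|[|k]] in IH cP cQ freq freq' by_latin gad *.
- have [p1 [p2 uP]] := uniq3_of_card p cP; have [q1 [q2 uQ]] := uniq3_of_card q cQ.
  exact: by_latin (latin_of_frequency1 freq uP) (latin_of_frequency1 freq' uQ).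
- exact: balanced_of_gadget_small cP cQ freq gad.
exact: balanced_of_gadget_large cP cQ freq gad.
Qed.

Theorem theorem3 (lambda : nat) (L : 'M['I_3]_(3 * lambda)) :
  1 <= lambda ->
  frequency_square L ->
  exists D : {set 'I_(3 * lambda) * 'I_(3 * lambda)},
    diagonal D /\ balanced L D.
Proof.
move=> _ freq; have cn : #|'I_(3 * lambda)| = 3 * lambda by rewrite card_ord.
have [D mD cD] := balanced_of_frequency cn cn (freq : frequency (fun i j => L i j) lambda).
(* The three colour counts add up to the order of the array, so the matching [D] meets every row and
   every column. *)
have cardD : #|D| = 3 * lambda.
  by rewrite -(cnt_sum (fun i j => L i j)) (eq_bigr _ (fun s _ => cD s)) sum_nat_const card_ord.
have rD i : i \in rows D.
  have : #|rows D| == #|'I_(3 * lambda)| by rewrite card_rows // cardD cn.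
  by move=> /eqP/subset_cardP/(_ (subset_predT _))->.
have kD j : j \in cols D.
  have : #|cols D| == #|'I_(3 * lambda)| by rewrite card_cols // cardD cn.
  by move=> /eqP/subset_cardP/(_ (subset_predT _))->.
exists D; split; last exact: cD.
split=> [i|j]; apply/eqP/cards1P.
  have /imsetP[c cM ic] := rD i; exists c; apply/setP => d; rewrite !inE ic.
  apply/andP/eqP => [[dM E]|->]; last by rewrite cM.
  by apply: (matchingP _ mD) => //; rewrite /conflict E.
have /imsetP[c cM jc] := kD j; exists c; apply/setP => d; rewrite !inE jc.
apply/andP/eqP => [[dM E]|->]; last by rewrite cM.
by apply: (matchingP _ mD) => //; rewrite /conflict E orbT.
Qed.
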